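(* In the reward setting described in the context, assume the threshold satisfies $B\ge\mu^*/2$. Then the (expected pseudo-)regret incurred by the subroutine RSE run with elimination threshold $B$ is at most $$\sum_{i:\Delta_i>0}\frac{289\log T}{\Delta_i}+12\min\{\bar d,\;D\Delta_{\max}\}\log K .$$
   Context: Delay-as-payoff bandit: there are $K$ arms, a horizon $T$ and a maximum delay $D\in\mathbb{N}$. Each arm $i\in[K]$ has an unknown distribution $\mathcal{D}_i$ supported on $\{0,1,\dots,D\}$. At each step $t$ the agent chooses an arm $i_t$ based on feedback observed so far, and a delay $d_t\sim\mathcal{D}_{i_t}$ is drawn independently; $d_t$ is revealed only at time $t+d_t$. The payoff of step $t$ is the reward $r_t=d_t/D$, to be maximized. Let $\mu(i)=\mathbb{E}_{X\sim\mathcal{D}_i}[X/D]$, $d(i)=D\mu(i)$, $\mu^*=\max_i\mu(i)$ attained at a unique arm $i^*$, $\Delta_i=\mu^*-\mu(i)$, $\Delta_{\max}=\max_i\Delta_i$, and $\bar d$ the second largest value among $d(1),\dots,d(K)$. Regret is $\mathbb{E}[\sum_t\Delta_{i_t}]$ over the steps played. Notation at time $t$: $n_t(i)$ is the number of steps $s\le t$ with $i_s=i$; $M_t(i)=\{s\le t: i_s=i,\ s+d_s\ge t\}$; $\mathcal{O}_t(i)=\{s\le t: i_s=i,\ s+d_s<t\}$; $F_t(i)=\{s\le t-D: i_s=i\}$; $a\vee b=\max\{a,b\}$. RSE (Reward Successive Elimination) with inputs $T$, $K$, $D$, threshold $B$: start with $t=1$ and $S=[K]$. While $t<T$: play each arm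 of $S$ once (round robin), observe arriving feedback, set $t\leftarrow t+|S|$; for each $i\in S$ compute $\hat\mu^+_t(i)=\frac{1}{n_t(i)}\big(|M_t(i)|+\sum_{s\in\mathcal{O}_t(i)}r_s\big)$, $U^1_t(i)=\hat\mu^+_t(i)+\sqrt{2\log T/n_t(i)}$, $\hat\mu^F_t(i)=\frac{1}{|F_t(i)|\vee1}\sum_{s\in F_t(i)}r_s$, $U^2_t(i)=\hat\mu^F_t(i)+\sqrt{2\log T/(|F_t(i)|\vee1)}$, $UCB_t(i)=\min\{U^1_t(i),U^2_t(i)\}$, $LCB_t(i)=\hat\mu^F_t(i)-\sqrt{2\log T/(|F_t(i)|\vee1)}$. Then remove from $S$ every arm $i$ for which some $j\in S$ has $\max\{LCB_t(j),B\}>UCB_t(i)$; if $S=\emptyset$ return (Fail, $t$). If the loop ends return (Success, $t$). *)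

(* Defs.v *)
From HB Require Import structures.
From mathcomp Require Import all_boot all_order all_algebra.
From mathcomp Require Import all_classical all_reals all_analysis.
Set Implicit Arguments. Unset Strict Implicit. Unset Printing Implicit Defensive.
Import Order.TTheory GRing.Theory Num.Theory.
Local Open Scope ring_scope.

(* Problem quantities.  p i x = P_{X ~ D_i}[X = x], x in {0,...,D}.    *)
Section Quantities.
Variables (R : realType) (K D : nat) (p : 'I_K -> 'I_D.+1 -> R).

Definition mu (i : 'I_K) : R := \sum_(x < D.+1) p i x * (x%:R / D%:R).
Definition dval (i : 'I_K) : R := D%:R * mu i.

Variable istar : 'I_K.
Definition mustar : R := mu istar.
Definition Delta (i : 'I_K) : R := mustar - mu i.
Definition Deltamax : R := \big[Num.max/0]_(i < K) Delta i.
(* second largest value among d(1..K) = largest d(j) over j <> i* (i* unique max) *)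
Definition dbar : R := \big[Num.max/0]_(j < K | j != istar) dval j.
End Quantities.

(* dseq`_k is the delay d_{k+1} of step k+1 (steps are 1-indexed);     *)
(* arms`_k is the arm i_{k+1} played at step k+1.                      *)
Section RSE.
Variables (R : realType) (K T D : nat) (B : R) (dseq : seq nat).

Definition delay (k : nat) : nat := nth 0%N dseq k.
Definition rew (k : nat) : R := (delay k)%:R / D%:R.

Section Stats.
Variables (t : nat) (arms : seq 'I_K) (i : 'I_K).
Definition armk (k : 'I_(size arms)) : 'I_K := tnth (in_tuple arms) k.
Definition nset : {set 'I_(size arms)} :=
  [set k : 'I_(size arms) | (k.+1 <= t)%N && (armk k == i)].
Definition Mset : {set 'I_(size arms)} :=
  [set k : 'I_(size arms) | [&& (k.+1 <= t)%N, armk k == i & (t <= k.+1 + delay k)%N]].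
Definition Oset : {set 'I_(size arms)} :=
  [set k : 'I_(size arms) | [&& (k.+1 <= t)%N, armk k == i & (k.+1 + delay k < t)%N]].
Definition Fset : {set 'I_(size arms)} :=
  [set k : 'I_(size arms) | (k.+1 + D <= t)%N && (armk k == i)].

Definition ncount : nat := #|nset|.
Definition Fcount : nat := maxn #|Fset| 1.
Definition mu_plus : R :=
  (#|Mset|%:R + \sum_(k in Oset) rew k) / ncount%:R.
Definition U1 : R := mu_plus + Num.sqrt (2 * ln T%:R / ncount%:R).
Definition muF : R := (\sum_(k in Fset) rew k) / Fcount%:R.
Definition U2 : R := muF + Num.sqrt (2 * ln T%:R / Fcount%:R).
Definition UCB : R := Num.min U1 U2.
Definition LCB : R := muF - Num.sqrt (2 * ln T%:R / Fcount%:R).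
End Stats.

(* One round: play S in increasing index order, advance t, eliminate.
   Returns the sequence of arms played at steps 1, 2, ...  The fuel only
   bounds the number of rounds; fuel = T is never exhausted since every
   round increases t by #|S| >= 1 and rounds only start while t < T. *)
Fixpoint rse_arms (fuel t : nat) (S : {set 'I_K}) (arms : seq 'I_K)
  : seq 'I_K :=
  match fuel with
  | 0 => arms
  | fuel'.+1 =>
    if (t < T)%N then
      let arms' := arms ++ enum S in
      let t' := (t + #|S|)%N in
      let S' := [set i in S | ~~ [exists j in S,
                   UCB t' arms' i < Num.max (LCB t' arms' j) B]] in
      if S' == finset.set0 then arms'
      else rse_arms fuel' t' S' arms'
    else arms
  end.
End RSE.

(* Expected regret of RSE: delays of steps 1..N are drawn so that the
   delay of step j+1 has law D_{i_{j+1}} (arm chosen adaptively; for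
   steps beyond those played, a dummy draw from D_{i*} which marginalizes
   out).  N = T + K bounds the number of steps played. *)
Definition rse_regret (R : realType) (K T D : nat) (p : 'I_K -> 'I_D.+1 -> R)
  (istar : 'I_K) (B : R) : R :=
  \sum_(w : {ffun 'I_(T + K) -> 'I_D.+1})
    let ds := [seq nat_of_ord (w j) | j <- enum 'I_(T + K)] in
    let arms := rse_arms T D B ds T 1 (finset.setT : {set 'I_K}) [::] in
    (\prod_(j < T + K) p (nth istar arms j) (w j)) *
    \sum_(a <- arms) Delta p istar a.

(* Main.v *)
(* Every quantity to control is a sum over the successive delays of one arm, and the product of the
   corresponding exponential factors is a supermartingale along the adaptive run.  This gives Hoeffding's bound
   for the mean of the first m rewards of arm i, and a Chernoff bound for the number of its plays still pending
   after m rounds when at least k arms have been active throughout: a play made j rounds ago is pending only if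
   its delay exceeds k j, so the expected number is at most d(i)/k + 1.  At most K T (K + 2) events are
   considered and each fails with probability at most T^-4, so that failures cost at most 4 Delta_max when K < T
   (when K >= T there is a single round).
   On the good event, let k be the number of arms active in the last round after which arm i is not eliminated.
   By the confidence intervals on observed feedback, i is played O(log T / Delta_i^2) times plus the D / k
   rounds whose feedback is missing, which costs D Delta_i / k.  If moreover dbar < D mu* / 6, then
   mu(i) < mu* / 6 and the bound on pending plays shows that the threshold B >= mu* / 2 eliminates i at a cost
   of 6 d(i) / k only.  In all cases the delay costs 6 min(dbar, D Delta_max) / k, where k is at least the rank
   of i when arms are sorted by decreasing elimination time, and the harmonic sum is at most 2 log K. *)
Require Import Defs.
From HB Require Import structures.
From mathcomp Require Import all_boot all_order all_algebra.
From mathcomp Require Import all_classical all_reals all_analysis.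
From mathcomp Require Import ring lra zify.
Set Implicit Arguments. Unset Strict Implicit. Unset Printing Implicit Defensive.
Import Order.TTheory GRing.Theory Num.Theory numFieldNormedType.Exports.
Local Open Scope ring_scope.

(** * Analytic inequalities *)

Lemma mvt_global (R : realType) (f df : R -> R) (a b : R) :
  (forall x : R, is_derive x 1 f (df x)) -> a <= b ->
  exists2 c, a <= c <= b & f b - f a = df c * (b - a).
Proof.
move=> df_f le_ab.
have cf : {within `[a, b], continuous f}%classic.
  apply: continuous_subspaceT => x.
  by apply: differentiable_continuous; apply/derivable1_diffP; case: (df_f x).
have [c] := MVT_segment le_ab (fun x _ => df_f x) cf.
by rewrite in_itv /= => ? ?; exists c.
Qed.

(** Hoeffding's lemma for a Bernoulli law. The logarithm of the left side has derivative [q], the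
    mean of the tilted law, and [q' = q (1 - q) <= 1/4]; two uses of the mean value theorem
    integrate this bound. *)
Lemma bernoulli_mgf_le (R : realType) (m l : R) : 0 <= m <= 1 ->
  1 - m + m * expR l <= expR (l * m + l ^+ 2 / 8).
Proof.
move=> /andP[m0 m1].
pose den (x : R) : R := 1 - m + m * expR x.
have den_gt0 x : 0 < den x.
  by rewrite /den; have := expR_gt0 x; move: m0; rewrite le0r => /orP[/eqP->|]; nra.
pose q (x : R) : R := m * expR x / den x.
have dden (x : R) : is_derive x 1 den (m * expR x).
  have -> : den = cst (1 - m) + m *: expR by apply/funext.
  by apply: is_derive_eq; rewrite add0r.
have dq (x : R) : is_derive x 1 q (q x * (1 - q x)).
  have dn : is_derive x 1 (fun y => m * expR y) (m * expR x).
    exact: (@is_deriveZ R R R expR m x 1 (expR x)).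
  have dv := @is_deriveV R den x _ 1 (lt0r_neq0 (den_gt0 x)) (dden x).
  have := is_deriveM dn dv; move/is_derive_eq; apply.
  rewrite /q /GRing.scale /= /den; field; exact: lt0r_neq0 (den_gt0 x).
have q01 x : 0 <= q x <= 1.
  apply/andP; split; first by rewrite divr_ge0 ?mulr_ge0 ?expR_ge0 // ltW.
  by rewrite /q ler_pdivrMr // mul1r /den lerDr subr_ge0.
have q0 : q 0 = m by rewrite /q /den expR0 mulr1 subrK divr1.
pose f x : R := x * m + x ^+ 2 / 8 - ln (den x).
have df (x : R) : is_derive x 1 f (m + x / 4 - q x).
  have dl : is_derive x 1 (@ln R \o den) ((den x)^-1 * (m * expR x)).
    by apply: is_derive1_comp; exact: is_derive1_ln.
  have -> : f = m *: id + 8^-1 *: (id ^+ 2) - (@ln R \o den).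
    by apply/funext => y; rewrite /f /GRing.scale /=; congr (_ - _);
      rewrite !fctE /GRing.scale /= mulrC [_ / 8]mulrC.
  apply: is_derive_eq; rewrite /GRing.scale /= /q; field.
  exact: lt0r_neq0 (den_gt0 x).
have f0 : f 0 = 0 by rewrite /f /den expR0 mulr1 subrK ln1; ring.
have : 0 <= f l.
  have [l0|l0] := leP 0 l.
    have [c /andP[c0 _]] := mvt_global df l0; rewrite f0 !subr0 => ->.
    apply: mulr_ge0 => //; have [d _] := mvt_global dq c0.
    by rewrite q0 subr0; have := mulr_ge0 c0 (sqr_ge0 (q d - 2^-1)); lra.
  have [c /andP[_ c0]] := mvt_global df (ltW l0).
  have [d _] := mvt_global dq c0; rewrite q0 !sub0r mulrN => Eq.
  rewrite f0 sub0r mulrN => /oppr_inj ->; rewrite nmulr_lge0 //.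
  by have := mulr_le0_ge0 c0 (sqr_ge0 (q d - 2^-1)); lra.
rewrite subr_ge0 -{1}(expRK (l * m + l ^+ 2 / 8)) => le_ln; move: le_ln.
by rewrite ler_ln ?posrE ?expR_gt0 //; exact: den_gt0.
Qed.

(** Convexity through tangents: the tangent of the exponential at [l * x] lies below the curve at
    [0] and at [l], and averaging with weights [1 - x] and [x] cancels the slopes. *)
Lemma expRM_le_chord (R : realType) (l x : R) : 0 <= x <= 1 ->
  expR (l * x) <= 1 - x + x * expR l.
Proof.
move=> /andP[x0 x1]; have e0 := expR_gt0 (l * x).
have t0 : expR (l * x) * (1 - l * x) <= 1.
  rewrite -ler_pdivlMl // mulr1 -expRN; exact: expR_ge1Dx.
have t1 : expR (l * x) * (1 + (l - l * x)) <= expR l.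
  rewrite -ler_pdivlMl // -expRN -expRD [- _ + _]addrC; exact: expR_ge1Dx.
have x1' : 0 <= 1 - x by rewrite subr_ge0.
have := ler_wpM2l x1' t0; have := ler_wpM2l x0 t1; lra.
Qed.

(** The chord bound reduces the law of [r] to the Bernoulli law with the same mean. *)
Lemma hoeffding_mgf (R : realType) (I : finType) (p r : I -> R) (l : R) :
  (forall x, 0 <= p x) -> \sum_x p x = 1 -> (forall x, 0 <= r x <= 1) ->
  \sum_x p x * expR (l * (r x - \sum_y p y * r y) - l ^+ 2 / 8) <= 1.
Proof.
move=> p0 p1 r01; set m := \sum_y p y * r y.
have m01 : 0 <= m <= 1.
  rewrite sumr_ge0 => [|x _]; last by rewrite mulr_ge0 //; case/andP: (r01 x).
  by rewrite -p1 ler_sum // => x _; rewrite ler_piMr //; case/andP: (r01 x).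
rewrite (eq_bigr (fun x => expR (- (l * m + l ^+ 2 / 8)) * (p x * expR (l * r x)))).
  rewrite -mulr_sumr expRN ler_pdivrMl ?expR_gt0 // mulr1.
  apply: le_trans (bernoulli_mgf_le l m01).
  have -> : 1 - m + m * expR l = \sum_x p x * (1 - r x + r x * expR l).
    rewrite (eq_bigr (fun x => p x - p x * r x + p x * r x * expR l)).
      by rewrite big_split big_split /= sumrN p1 -mulr_suml.
    by move=> x _; ring.
  by apply: ler_sum => x _; rewrite ler_wpM2l // expRM_le_chord.
by move=> x _; rewrite mulrCA -expRD; congr (_ * expR _); ring.
Qed.

Lemma expR_half_le (R : realType) : expR 2^-1 <= 7 / 4 :> R.
Proof.
have e8 : expR (8^-1) <= 8 / 7 :> R.
  rewrite -[leLHS]invrK -expRN -[leRHS]invrK lef_pV2 ?posrE ?expR_gt0 //.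
  by apply: le_trans (expR_ge1Dx _); lra.
have -> : 2^-1 = 4%:R * 8^-1 :> R by field.
rewrite expRM_natl; apply: le_trans (lerXn2r 4 _ _ e8) _; rewrite ?nnegrE ?expR_ge0 //.
by lra.
Qed.

(** Chernoff factor at parameter 1/2: since [expR 2^-1 - 1 <= 3/4], the exponential moment is at
    most [1 + 3/4 q], hence at most [expR (3/4 q)]. *)
Lemma indicator_mgf (R : realType) (I : finType) (p : I -> R) (P : pred I) :
  (forall x, 0 <= p x) -> \sum_x p x = 1 ->
  \sum_x p x * expR (2^-1 * (P x)%:R - 3 / 4 * \sum_(y | P y) p y) <= 1.
Proof.
move=> p0 p1; set q := \sum_(y | P y) p y.
rewrite (eq_bigr (fun x => expR (- (3 / 4 * q)) * (p x * expR (2^-1 * (P x)%:R)))).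
  rewrite -mulr_sumr expRN ler_pdivrMl ?expR_gt0 // mulr1.
  apply: le_trans (expR_ge1Dx _).
  have -> : 1 + 3 / 4 * q = \sum_x p x * (1 + 3 / 4 * (P x)%:R).
    rewrite (eq_bigr (fun x => p x + 3 / 4 * (if P x then p x else 0))).
      by rewrite big_split /= p1 -mulr_sumr -big_mkcond.
    by move=> x _; case: (P x); rewrite /=; ring.
  apply: ler_sum => x _; rewrite ler_wpM2l //.
  by case: (P x) => /=; rewrite ?mulr1 ?mulr0 ?addr0 ?expR0 //; have := @expR_half_le R; lra.
by move=> x _; rewrite mulrCA -expRD; congr (_ * expR _); ring.
Qed.

(** * Logarithms and harmonic sums *)

Lemma ln_nat_ge_half (R : realType) (n : nat) : (2 <= n)%N -> 2^-1 <= ln (n%:R : R).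
Proof.
move=> n2; have n0 : (0 : R) < n%:R by rewrite ltr0n (leq_trans _ n2).
have := @le_ln1Dx R (n%:R^-1 - 1).
rewrite [1 + _]addrC subrK lnV ?posrE // lerNl opprB ltrBrDl subrr invr_gt0.
move=> /(_ n0); apply: le_trans.
rewrite lerBrDl -lerBrDr (_ : 1 - 2^-1 = 2^-1); last by field.
by rewrite lef_pV2 ?posrE // ler_nat.
Qed.

(** Each new term is at most [2 / (n + 2)], and [1 / (n + 2) <= - ln (1 - 1 / (n + 2))]
    telescopes. *)
Lemma harmonic_le_ln (R : realType) (n : nat) :
  \sum_(k < n) (k.+1%:R^-1 : R) <= 2 * ln n.+1%:R.
Proof.
elim: n => [|n IHn]; first by rewrite big_ord0 ln1 mulr0.
rewrite big_ord_recr /=; apply: le_trans (lerD IHn (lexx _)) _.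
have n1 : (0 : R) < n.+1%:R by [].
have n2 : (0 : R) < n.+2%:R by [].
have := @le_ln1Dx R (- n.+2%:R^-1).
have -> : 1 + - n.+2%:R^-1 = (n.+1%:R / n.+2%:R : R).
  apply: (mulIf (lt0r_neq0 n2)); rewrite divfK ?lt0r_neq0 // mulrDl mulNr.
  by rewrite mulVf ?lt0r_neq0 // mul1r -[n.+2%:R]natr1 addrK.
rewrite ln_div ?posrE // ltrN2 invf_lt1 // ltr1n => /(_ isT).
have : (n.+1%:R^-1 : R) <= 2 * n.+2%:R^-1.
  rewrite -[_^-1]mul1r ler_pdivrMr // mulrAC ler_pdivlMr // mul1r -natrM ler_nat.
  by rewrite mul2n -addnn addSnnS leq_addl.
move: (ln _) (ln _) (_^-1) (_^-1) => a b c d; lra.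
Qed.

(** Remove a minimiser of [N]: its rank is [#|A|], and the ranks of the others can only decrease
    within the smaller set. Ties enlarge ranks, whence an inequality. *)
Lemma sum_inv_rank_le (R : realType) (I : finType) (A : {set I}) (N : I -> nat) :
  \sum_(i in A) (#|[set j in A | (N i <= N j)%N]|%:R^-1 : R) <=
  \sum_(k < #|A|) k.+1%:R^-1.
Proof.
elim: {A}_.+1 {-2}A (ltnSn #|A|) => // n IHn A An.
have [->|/set0Pn[a0 a0A]] := eqVneq A finset.set0.
  by rewrite big_set0 sumr_ge0 // => i _; rewrite invr_ge0.
case: (arg_minnP N a0A) => a /= aA' amin; have aA : a \in A := aA'.
have cA : #|A| = #|A :\ a|.+1 by rewrite (cardsD1 a) aA.
rewrite (big_setD1 a) //= cA big_ord_recr /= addrC lerD //; last first.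
  rewrite (_ : [set j in A | _] = A) ?cA //.
  by apply/setP => j; rewrite inE; case: (boolP (j \in A)) => // /amin ->.
apply: le_trans (IHn (A :\ a) _); last by rewrite -ltnS -cA.
apply: ler_sum => i iA; rewrite lef_pV2 ?posrE ?ltr0n ?card_gt0.
- rewrite ler_nat subset_leq_card //; apply/fintype.subsetP => j.
  by rewrite !inE => /andP[/andP[_ ->] ->].
- by apply/set0Pn; exists i; rewrite inE leqnn andbT; case/setD1P: iA.
- by apply/set0Pn; exists i; rewrite inE leqnn andbT.
Qed.

(** * The adaptive run *)

(** The supermartingale inequality, with [q s] a subprobability given the history [s]. The induction
    peels off the first draw, which [h] prepends, and passes to the kernel on histories that start
    with it. *)
Lemma adaptive_mass_le1 (R : realType) (X : finType) (v : X -> nat) (n : nat)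
    (q : seq nat -> X -> R) :
  (forall s x, 0 <= q s x) -> (forall s, \sum_x q s x <= 1) ->
  \sum_(w : {ffun 'I_n -> X})
    \prod_(j < n) q (take j [seq v (w i) | i <- enum 'I_n]) (w j) <= 1.
Proof.
elim: n q => [|n IHn] q q0 q1.
  rewrite (eq_bigr (fun=> 1)) => [|w _]; last by rewrite big_ord0.
  by rewrite sumr_const card_ffun card_ord expn0.
pose h (xw : X * {ffun 'I_n -> X}) : {ffun 'I_n.+1 -> X} :=
  [ffun i => oapp xw.2 xw.1 (unlift ord0 i)].
have h0 x w : h (x, w) ord0 = x by rewrite ffunE unlift_none.
have hS x w i : h (x, w) (lift ord0 i) = w i by rewrite ffunE liftK.
rewrite (reindex h) /=; last first.
  exists (fun w => (w ord0, [ffun i => w (lift ord0 i)])) => [[x w]|w] _.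
    by rewrite h0; congr (_, _); apply/ffunP => i; rewrite ffunE hS.
  apply/ffunP => i; case: (unliftP ord0 i) => [j|] ->; rewrite ?h0 ?hS ?ffunE //.
rewrite -(pair_big xpredT xpredT (fun x w => \prod_(j < n.+1)
  q (take j [seq v (h (x, w) i) | i <- enum 'I_n.+1]) (h (x, w) j))) /=.
apply: le_trans (q1 [::]); apply: ler_sum => x _.
rewrite (eq_bigr (fun w : {ffun 'I_n -> X} => q [::] x * \prod_(j < n)
    q (v x :: take j [seq v (w i) | i <- enum 'I_n]) (w j))); last first.
  move=> w _; rewrite big_ord_recl h0 take0; congr (_ * _).
  apply: eq_bigr => j _; rewrite hS enum_ordSl /= h0 -map_comp; congr (q (_ :: take _ _) _).
  by apply: eq_map => i /=; rewrite hS.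
by rewrite -mulr_sumr ler_piMr // (IHn (fun s => q (v x :: s))).
Qed.

Section Execution.
Variables (R : realType) (K T D : nat) (B : R).
Implicit Types (ds : seq nat) (arms : seq 'I_K) (S : {set 'I_K}).

Definition survivors ds t arms S : {set 'I_K} :=
  [set i in S | ~~ [exists j in S,
     UCB R T D ds t arms i < Num.max (LCB R T D ds t arms j) B]].

Lemma rse_armsE ds fuel t S arms :
  rse_arms T D B ds fuel.+1 t S arms =
  if (t < T)%N then
    let arms' := arms ++ enum S in
    let S' := survivors ds (t + #|S|) arms' S in
    if S' == finset.set0 then arms' else rse_arms T D B ds fuel (t + #|S|) S' arms'
  else arms.
Proof. by []. Qed.

(** The statistics range over ['I_(size arms)], so they read only the delays of steps already
    played. *)
Lemma survivors_eq ds ds' t arms S :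
  {in gtn (size arms), nth 0 ds =1 nth 0 ds'}%N ->
  survivors ds t arms S = survivors ds' t arms S.
Proof.
move=> eq_ds; have dE (k : 'I_(size arms)) : delay ds k = delay ds' k.
  by apply: eq_ds; exact: ltn_ord.
have ME i : @Mset K ds t arms i = @Mset K ds' t arms i.
  by apply/setP => k; rewrite !inE dE.
have OE i : @Oset K ds t arms i = @Oset K ds' t arms i.
  by apply/setP => k; rewrite !inE dE.
have FE i : muF R D ds t arms i = muF R D ds' t arms i.
  by rewrite /muF; congr (_ / _); apply: eq_bigr => k _; rewrite /rew dE.
apply/setP => i; rewrite !inE; congr (_ && ~~ _); apply: eq_existsb => j.
rewrite /UCB /LCB /U2 !FE /U1 /mu_plus ME OE.
by under eq_bigr do rewrite /rew dE.
Qed.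

Lemma rse_arms_prefix ds fuel t S arms :
  exists s, rse_arms T D B ds fuel t S arms = arms ++ s.
Proof.
elim: fuel t S arms => [|fuel IH] t S arms; first by exists [::]; rewrite cats0.
rewrite rse_armsE; case: ifP => _; last by exists [::]; rewrite cats0.
move=> /=; case: ifP => _; first by exists (enum S).
by have [s ->] := IH (t + #|S|)%N (survivors ds (t + #|S|) (arms ++ enum S) S) (arms ++ enum S);
  exists (enum S ++ s); rewrite catA.
Qed.

(** If step [j] lies in the current round or before, later rounds only append to it; otherwise the
    elimination that ends the round reads only delays before [j]. *)
Lemma rse_arms_nonanticipating i0 ds ds' j fuel t S arms :
  {in gtn j, nth 0 ds =1 nth 0 ds'}%N ->
  nth i0 (rse_arms T D B ds fuel t S arms) j =
  nth i0 (rse_arms T D B ds' fuel t S arms) j.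
Proof.
move=> eq_ds; elim: fuel t S arms => [|fuel IH] t S arms //.
have [lt_j|le_j] := ltnP j (size (arms ++ enum S)).
  have nthE ds1 : nth i0 (rse_arms T D B ds1 fuel.+1 t S arms) j =
      nth i0 (if (t < T)%N then arms ++ enum S else arms) j.
    rewrite rse_armsE; case: ifP => //= _; case: ifP => // _.
    by have [s ->] := rse_arms_prefix ds1 fuel (t + #|S|)
      (survivors ds1 (t + #|S|) (arms ++ enum S) S) (arms ++ enum S); rewrite nth_cat lt_j.
  by rewrite !nthE.
rewrite !rse_armsE; case: ifP => // _ /=; rewrite (@survivors_eq ds ds').
  by case: ifP.
by move=> k /= lt_k; apply: eq_ds; apply: leq_trans lt_k le_j.
Qed.

(* [Ss] lists the sets of active arms, round by round. *)
Definition played (Ss : seq {set 'I_K}) : seq 'I_K :=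
  flatten (map (fun A : {set 'I_K} => enum A) Ss).

(** Removes the fuel: afterwards the algorithm enters only through these four clauses, on the arms
    played, the initial set, the starting time of each round and the elimination rule. *)
Lemma rse_trace ds fuel t S arms : S != finset.set0 ->
  exists Ss : seq {set 'I_K},
  [/\ rse_arms T D B ds fuel t S arms = arms ++ played Ss,
      (0 < size Ss)%N -> nth finset.set0 Ss 0 = S,
      forall m, (m < size Ss)%N -> (t + size (played (take m Ss)) < T)%N &
      forall m, (m.+1 < size Ss)%N ->
        nth finset.set0 Ss m.+1 =
        survivors ds (t + size (played (take m.+1 Ss))) (arms ++ played (take m.+1 Ss))
          (nth finset.set0 Ss m)].
Proof.
elim: fuel t S arms => [|fuel IH] t S arms S0.
  by exists [::]; split=> //; rewrite /played /= cats0.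
rewrite rse_armsE; case: ifP => [tT|_]; last by exists [::]; split=> //; rewrite /played /= cats0.
move=> /=; case: ifP => [_|/negbT S'0].
  exists [:: S]; split=> //; first by rewrite /played /= cats0.
  by case=> // _; rewrite /played /= addn0.
have [Ss [-> hd time next]] := IH (t + #|S|)%N _ (arms ++ enum S) S'0.
exists (S :: Ss); split=> //=; first by rewrite catA.
  case=> [|m]; rewrite /played /= ?addn0 // ltnS => /time.
  by rewrite size_cat -cardE addnA.
case=> [|m]; rewrite ltnS => sm.
  by rewrite hd // /played /= take0 /= cats0 -cardE.
rewrite [LHS](next m sm) -catA -addnA.
by rewrite [size (played (S :: _))]size_cat -cardE.
Qed.
End Execution.

(** * Rounds and positions of plays *)

Lemma big_nth_eq (M : Type) (idx : M) (op : Monoid.com_law idx) (X : eqType)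
    (x0 x : X) (s : seq X) (F : nat -> M) : uniq s ->
  \big[op/idx]_(0 <= k < size s | nth x0 s k == x) F k =
  if x \in s then F (index x s) else idx.
Proof.
move=> us; rewrite big_mkord; case: ifP => xs.
  have lt_x : (index x s < size s)%N by rewrite index_mem.
  rewrite (big_pred1 (Ordinal lt_x)) // => k /=.
  by rewrite -val_eqE /= -(nth_uniq x0 (ltn_ord k) lt_x us) nth_index.
rewrite big_pred0 // => k; apply/negP => /eqP E.
by rewrite -E mem_nth in xs.
Qed.

Section Rounds.
Variables (K : nat) (Ss : seq {set 'I_K}).
Local Notation S_ := (nth finset.set0 Ss).
Hypothesis nested : forall m, S_ m.+1 \subset S_ m.

(** For nested active sets, the index of the first one without [i] (the length of [Ss] if there is
    none) is the number of plays of [i]. *)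
Definition nplays (i : 'I_K) : nat := find (fun A : {set 'I_K} => i \notin A) Ss.

(* Steps are numbered from 0 here, from 1 in the paper. *)
Definition position (i : 'I_K) (c : nat) : nat :=
  (size (played (take c Ss)) + index i (enum (S_ c)))%N.

Lemma nested_le l m : (l <= m)%N -> S_ m \subset S_ l.
Proof.
move=> /subnK <-; elim: (m - l)%N => [|d IH]; first by rewrite add0n.
exact: fintype.subset_trans (nested _) IH.
Qed.

Lemma mem_active i m : (i \in S_ m) = (m < nplays i)%N.
Proof.
apply/idP/idP => [iS|/(before_find finset.set0)/negbFE //].
rewrite ltnNge; apply/negP => le_m.
have [lt_n|] := ltnP (nplays i) (size Ss).
  have := @nth_find _ finset.set0 (fun A : {set 'I_K} => i \notin A) Ss; rewrite has_find => /(_ lt_n)/negP; apply.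
  exact: (fintype.subsetP (nested_le le_m)).
by move=> le_n; move: iS; rewrite nth_default ?inE // (leq_trans le_n).
Qed.

Lemma nplays_le_size i : (nplays i <= size Ss)%N. Proof. exact: find_size. Qed.

Lemma playedS m : (m < size Ss)%N ->
  played (take m.+1 Ss) = played (take m Ss) ++ enum (S_ m).
Proof.
by move=> lt_m; rewrite (take_nth finset.set0) // -cats1 /played map_cat flatten_cat /= cats0.
Qed.

Lemma size_playedS m : (m < size Ss)%N ->
  size (played (take m.+1 Ss)) = (size (played (take m Ss)) + #|S_ m|)%N.
Proof. by move=> lt_m; rewrite playedS // size_cat -cardE. Qed.

(** A round plays each active arm exactly once, so sums over the steps of [i] become sums over
    rounds. *)
Lemma big_played (M : Type) (idx : M) (op : Monoid.com_law idx) x0 i m (F : nat -> M) :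
  (m <= size Ss)%N ->
  \big[op/idx]_(0 <= k < size (played (take m Ss)) |
      nth x0 (played (take m Ss)) k == i) F k =
  \big[op/idx]_(0 <= c < m | i \in S_ c) F (position i c).
Proof.
elim: m => [|m IH] lt_m; first by rewrite take0 !big_geq.
rewrite playedS // size_cat (big_cat_nat (n := size (played (take m Ss)))) ?leq_addr //=.
rewrite [RHS](big_cat_nat (n := m)) //= -IH 1?ltnW //; congr (op _ _).
  rewrite [LHS]big_nat_cond [RHS]big_nat_cond; apply: eq_bigl => k.
  by case: ltnP => //= lt_k; rewrite nth_cat lt_k.
rewrite -{1}[size (played (take m Ss))]add0n big_addn addKn.
rewrite (eq_bigl (fun k => nth x0 (enum (S_ m)) k == i)); last first.
  by move=> k; rewrite nth_cat ltnNge leq_addl /= addnK.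
rewrite (big_nth_eq _ _ _ (fun k => F (k + size (played (take m Ss)))%N)) ?enum_uniq //.
rewrite big_mkcond big_nat1 mem_enum; case: ifP => // _.
by rewrite /position addnC.
Qed.

Lemma big_active (M : Type) (idx : M) (op : Monoid.law idx) i m (F : nat -> M) :
  (m <= nplays i)%N ->
  \big[op/idx]_(0 <= c < m | i \in S_ c) F c = \big[op/idx]_(0 <= c < m) F c.
Proof.
move=> le_m; rewrite big_nat_cond [RHS]big_nat_cond; apply: eq_bigl => c /=.
by rewrite andbT; case: ltnP => //= lt_c; rewrite mem_active (leq_trans lt_c).
Qed.

Lemma position_lt i c : (c < nplays i)%N ->
  (position i c < size (played (take c.+1 Ss)))%N.
Proof.
move=> lt_c; rewrite size_playedS; last exact: leq_trans lt_c (nplays_le_size _).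
by rewrite /position ltn_add2l cardE index_mem mem_enum mem_active.
Qed.

Lemma nth_played_take x0 m k : (k < size (played (take m Ss)))%N ->
  nth x0 (played (take m Ss)) k = nth x0 (played Ss) k.
Proof.
move=> lt_k; rewrite -[in RHS](cat_take_drop m Ss) /played map_cat flatten_cat.
by rewrite nth_cat lt_k.
Qed.

(** Identifies the running count of plays, which the weights below use, with the round number. *)
Lemma count_before_position x0 i c : (c < nplays i)%N ->
  (\sum_(0 <= l < position i c) (nth x0 (played Ss) l == i))%N = c.
Proof.
move=> lt_c; have lt_n : (c < size Ss)%N := leq_trans lt_c (nplays_le_size _).
rewrite (big_cat_nat (n := size (played (take c Ss)))) ?leq_addr //=.
have -> : (\sum_(0 <= l < size (played (take c Ss))) (nth x0 (played Ss) l == i))%N = c.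
  have := @big_played _ _ addn x0 i c (fun=> 1%N) (ltnW lt_n).
  rewrite big_active 1?ltnW // sum_nat_const_nat muln1 subn0 => E; rewrite -[RHS]E.
  rewrite [RHS]big_mkcond /=; apply: eq_big_nat => l /andP[_ lt_l].
  by rewrite nth_played_take //; case: (_ == _).
rewrite big_nat_cond big1 ?addn0 // => l /andP[/andP[le_l lt_l] _].
rewrite -(@nth_played_take _ c.+1); last exact: ltn_trans lt_l (position_lt lt_c).
rewrite playedS // nth_cat ltnNge le_l /=; apply/eqP; rewrite eqb0; apply/negP => /eqP.
have lt_i : (l - size (played (take c Ss)) < index i (enum (S_ c)))%N.
  by rewrite ltn_subLR.
by move=> E; have := before_find x0 lt_i; rewrite /= E eqxx.
Qed.

(** Steps beyond the run read the default arm [x0], possibly [i] itself; the count shows that they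
    come after all genuine plays of [i]. *)
Lemma count_played_ge x0 i j : (size (played Ss) <= j)%N ->
  (nplays i <= \sum_(0 <= l < j) (nth x0 (played Ss) l == i))%N.
Proof.
move=> le_j; rewrite (big_cat_nat (n := size (played Ss))) //=.
apply: leq_trans (leq_addr _ _).
have := @big_played _ _ addn x0 i (size Ss) (fun=> 1%N) (leqnn _).
rewrite take_size big_mkcond /= => E.
rewrite (eq_bigr (fun l => if nth x0 (played Ss) l == i then 1 else 0)%N); last first.
  by move=> l _; case: (_ == _).
rewrite E (big_cat_nat (n := nplays i)) ?nplays_le_size //=.
by rewrite big_active // sum_nat_const_nat muln1 subn0 leq_addr.
Qed.

Lemma sum_played (V : nmodType) (F : 'I_K -> V) :
  \sum_(a <- played Ss) F a = \sum_i F i *+ nplays i.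
Proof.
have -> : \sum_(a <- played Ss) F a = \sum_(0 <= m < size Ss) \sum_(i in S_ m) F i.
  rewrite /played big_flatten big_map (big_nth finset.set0).
  by apply: eq_bigr => m _; rewrite big_enum.
transitivity (\sum_(0 <= m < size Ss) \sum_(i : 'I_K) if i \in S_ m then F i else 0).
  by apply: eq_bigr => m _; rewrite big_mkcond.
rewrite exchange_big; apply: eq_bigr => i _.
rewrite (big_cat_nat (n := nplays i)) ?nplays_le_size //=.
rewrite [X in _ + X](_ : _ = 0) ?addr0; last first.
  rewrite big_nat_cond big1 // => m /andP[/andP[le_m _] _].
  by rewrite mem_active ltnNge le_m.
transitivity (\sum_(0 <= m < nplays i) F i); last by rewrite sumr_const_nat subn0.
by apply: eq_big_nat => m /andP[_ lt_m]; rewrite mem_active lt_m.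
Qed.

End Rounds.

(** * Confidence bounds *)

Lemma big_initial (M : Type) (idx : M) (op : Monoid.law idx) (Q : pred nat) m (F : nat -> M) :
  (forall c c', (c <= c' < m)%N -> Q c' -> Q c) ->
  \big[op/idx]_(0 <= c < m | Q c) F c =
  \big[op/idx]_(0 <= c < \sum_(0 <= c < m) Q c) F c.
Proof.
elim: m => [|m IH] closedQ; first by rewrite !big_geq.
have closedQ' c c' : (c <= c' < m)%N -> Q c' -> Q c.
  by case/andP=> le_c lt_c; apply: closedQ; rewrite le_c ltnW.
rewrite [in RHS]big_nat_recr //= big_mkcond big_nat_recr //= -big_mkcond IH //.
case: ifP => Qm; last by rewrite addn0 Monoid.mulm1.
have -> : (\sum_(0 <= c < m) Q c = m)%N.
  rewrite (eq_big_nat _ _ (F2 := fun=> 1%N)); first by rewrite sum_nat_const_nat muln1 subn0.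
  by move=> c /andP[_ lt_c]; rewrite (closedQ c m _ Qm) // ltnSn ltnW.
by rewrite addn1 big_nat_recr.
Qed.

(** * Statistics of an arm as sums over its successive plays *)

Section Statistics.
Variables (R : realType) (K T D : nat) (ds : seq nat) (Ss : seq {set 'I_K}).
Local Notation S_ := (nth finset.set0 Ss).
Hypothesis nested : forall m, S_ m.+1 \subset S_ m.
Local Notation arms_ m := (played (take m Ss)).
Local Notation time_ m := (1 + size (arms_ m))%N.

Definition play_delay (i : 'I_K) (c : nat) : nat := delay ds (position Ss i c).

Lemma big_armk (M : Type) (idx : M) (op : Monoid.com_law idx) i m (P : pred nat) (F : nat -> M) :
  (m <= nplays Ss i)%N ->
  \big[op/idx]_(k < size (arms_ m) | (armk k == i) && P k) F k =
  \big[op/idx]_(0 <= c < m | P (position Ss i c)) F (position Ss i c).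
Proof.
move=> le_m; have le_n := leq_trans le_m (nplays_le_size _ _).
rewrite big_mkcondr /=.
rewrite (eq_bigl (fun k : 'I_(size (arms_ m)) => nth i (arms_ m) k == i)); last first.
  by move=> k; rewrite /armk (tnth_nth i).
rewrite -(big_mkord (fun k => nth i (arms_ m) k == i) (fun k => if P k then F k else idx)).
by rewrite big_played // big_active // -big_mkcond.
Qed.

Lemma size_played_gap l m : (l <= m <= size Ss)%N ->
  (size (arms_ l) + #|S_ m.-1| * (m - l) <= size (arms_ m))%N.
Proof.
elim: m => [|m IH]; first by rewrite leqn0 => /andP[/eqP ->]; rewrite subnn muln0 addn0.
case/andP; rewrite leq_eqVlt => /orP[/eqP <- _|]; first by rewrite subnn muln0 addn0.
rewrite ltnS => le_l lt_m; rewrite size_playedS // subSn //= mulnS addnCA [leqRHS]addnC leq_add2l.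
apply: leq_trans (IH _); last by rewrite le_l ltnW.
rewrite leq_add2l leq_mul2r; apply/orP; right; apply: subset_leq_card.
exact: nested_le nested _ _ (leq_pred m).
Qed.

(** After round [c] come [m.-1 - c] full rounds, each with at least as many steps as round
    [m.-1]. *)
Lemma position_gap i c m : (c < m <= nplays Ss i)%N ->
  (position Ss i c + #|S_ m.-1| * (m.-1 - c) < size (arms_ m))%N.
Proof.
case/andP=> lt_c le_m; apply: leq_trans (@size_played_gap c.+1 m _); last first.
  by rewrite lt_c (leq_trans le_m) ?nplays_le_size.
rewrite -addSn leq_add ?position_lt ?(leq_trans lt_c) //.
by rewrite leq_mul2l; apply/orP; right; lia.
Qed.

Lemma position_incr i c c' : (c < c' < nplays Ss i)%N ->
  (position Ss i c < position Ss i c')%N.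
Proof.
case/andP=> lt_c lt_c'; apply: leq_trans (leq_addr _ _).
apply: leq_trans (@size_played_gap c.+1 c' _); first last.
  by rewrite lt_c ltnW // (leq_trans lt_c') ?nplays_le_size.
by apply: leq_trans (leq_addr _ _); rewrite position_lt // (ltn_trans lt_c).
Qed.

Lemma active_gt0 i m : (0 < m <= nplays Ss i)%N -> (0 < #|S_ m.-1|)%N.
Proof.
case/andP=> m0 le_m; rewrite card_gt0; apply/set0Pn; exists i.
by rewrite mem_active // prednK.
Qed.

Section Arm.
Variables (i : 'I_K) (m : nat).
Hypothesis m_plays : (0 < m <= nplays Ss i)%N.
Let k := #|S_ m.-1|.
Let le_m : (m <= nplays Ss i)%N := proj2 (andP m_plays).

Lemma ncountE : ncount (time_ m) (arms_ m) i = m.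
Proof.
rewrite /ncount -sum1_card.
rewrite (eq_bigl (fun k : 'I_(size (arms_ m)) => (armk k == i) && true)).
  by rewrite (big_armk addn predT (fun=> 1%N)) // sum_nat_const_nat muln1 subn0.
by move=> l; rewrite inE andbT add1n ltnS ltnW.
Qed.

(** A play is pending only if its delay reaches the end of round [m.-1], and [position_gap] bounds
    from below the steps elapsed since. *)
Lemma Mset_le : (#|Mset ds (time_ m) (arms_ m) i| <=
  \sum_(0 <= c < m) (k * (m.-1 - c) < play_delay i c))%N.
Proof.
rewrite -sum1_card.
rewrite (eq_bigl (fun l : 'I_(size (arms_ m)) =>
    (armk l == i) && (time_ m <= l.+1 + delay ds l)%N)); last first.
  by move=> l; rewrite inE add1n ltnS ltnW.
rewrite (big_armk addn (fun l => (time_ m <= l.+1 + delay ds l)%N) (fun=> 1%N)) //.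
rewrite big_mkcond /= big_nat_cond [leqRHS]big_nat_cond.
apply: leq_sum => c /andP[/andP[_ lt_c] _]; case: ifP => //.
have := @position_gap i c m; rewrite lt_c le_m => /(_ isT).
rewrite /play_delay -/k => gap late; rewrite (_ : (_ < _)%N) //.
lia.
Qed.

Lemma Oset_sum_le : \sum_(l in Oset ds (time_ m) (arms_ m) i) rew R D ds l <=
  \sum_(0 <= c < m) (play_delay i c)%:R / D%:R.
Proof.
rewrite (eq_bigl (fun l : 'I_(size (arms_ m)) =>
    (armk l == i) && (l.+1 + delay ds l < time_ m)%N)); last first.
  by move=> l; rewrite inE add1n ltnS ltnW.
rewrite (big_armk _ (fun l => (l.+1 + delay ds l < time_ m)%N) (rew R D ds)) //.
rewrite big_mkcond /=; apply: ler_sum => c _; case: ifP => // _; exact: divr_ge0.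
Qed.

(* A late play still counts at least its reward, so the optimistic mean dominates the true one. *)
Lemma mu_plus_ge :
  (forall l, (delay ds l <= D)%N) -> (0 < D)%N ->
  (\sum_(0 <= c < m) (play_delay i c)%:R / D%:R) / m%:R <=
  mu_plus R D ds (time_ m) (arms_ m) i.
Proof.
move=> dsD D0; rewrite /mu_plus ncountE ler_wpM2r ?invr_ge0 //.
have D0R : (0 : R) < D%:R by rewrite ltr0n.
rewrite -sum1_card natr_sum.
rewrite (eq_bigl (fun l : 'I_(size (arms_ m)) =>
    (armk l == i) && (time_ m <= l.+1 + delay ds l)%N)); last first.
  by move=> l; rewrite inE add1n ltnS ltnW.
rewrite [X in _ <= _ + X](eq_bigl (fun l : 'I_(size (arms_ m)) =>
    (armk l == i) && (l.+1 + delay ds l < time_ m)%N)); last first.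
  by move=> l; rewrite inE add1n ltnS ltnW.
rewrite (big_armk _ (fun l => (time_ m <= l.+1 + delay ds l)%N) (fun=> 1)) //.
rewrite (big_armk _ (fun l => (l.+1 + delay ds l < time_ m)%N) (rew R D ds)) //.
rewrite [X in _ <= X + _]big_mkcond [X in _ <= _ + X]big_mkcond -big_split /=.
apply: ler_sum => c _; rewrite /rew /play_delay; case: leqP => _ /=; last by rewrite add0r.
by rewrite addr0 ler_pdivrMr // mul1r ler_nat.
Qed.

(* The observed window is an initial segment of the plays, missing at most the last [D %/ k + 1]. *)
Lemma Fset_initial : exists f, [/\ (m.-1 - D %/ k <= f <= m)%N,
  #|Fset D (time_ m) (arms_ m) i| = f &
  \sum_(l in Fset D (time_ m) (arms_ m) i) rew R D ds l =
  \sum_(0 <= c < f) (play_delay i c)%:R / D%:R].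
Proof.
pose Q c := ((position Ss i c).+1 + D <= time_ m)%N.
have FE l : (l \in Fset D (time_ m) (arms_ m) i) = (armk l == i) && (l.+1 + D <= time_ m)%N.
  by rewrite inE andbC.
have closedQ c c' : (c <= c' < m)%N -> Q c' -> Q c.
  case/andP; rewrite leq_eqVlt => /orP[/eqP-> //|lt_c] lt_c'; apply: leq_trans.
  rewrite leq_add2r ltnS ltnW // position_incr // lt_c /=; exact: leq_trans lt_c' le_m.
exists (\sum_(0 <= c < m) Q c)%N; split.
- apply/andP; split; last first.
    rewrite -[leqRHS]subn0 -[leqRHS]muln1 -sum_nat_const_nat.
    by apply: leq_sum => c _; case: (Q c).
  have le_f : (m.-1 - D %/ k <= m)%N := leq_trans (leq_subr _ _) (leq_pred _).
  rewrite (big_cat_nat (n := (m.-1 - D %/ k)%N)) //=; apply: leq_trans (leq_addr _ _).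
  rewrite -[leqLHS]subn0 -[leqLHS]muln1 -sum_nat_const_nat.
  rewrite big_nat_cond [leqRHS]big_nat_cond; apply: leq_sum => c /andP[/andP[_ lt_c] _].
  rewrite lt0b /Q; have := @position_gap i c m; rewrite le_m andbT -/k.
  have k0 : (0 < k)%N := active_gt0 m_plays.
  have Dk : (D < k * (D %/ k).+1)%N by rewrite mulnC ltn_ceil.
  have : (k * (D %/ k).+1 <= k * (m.-1 - c))%N by rewrite leq_mul2l; lia.
  lia.
- rewrite -sum1_card (eq_bigl _ _ FE) (big_armk addn (fun l => (l.+1 + D <= time_ m)%N) (fun=> 1%N)) //.
  by rewrite big_mkcond /=; apply: eq_bigr => c _; rewrite /Q; case: leqP.
rewrite (eq_bigl _ _ FE) (big_armk _ (fun l => (l.+1 + D <= time_ m)%N) (rew R D ds)) //.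
exact: big_initial.
Qed.
End Arm.
End Statistics.

Lemma mu_bounds (R : realType) (K D : nat) (p : 'I_K -> 'I_D.+1 -> R) i :
  (0 < D)%N -> (forall i x, 0 <= p i x) -> (forall i, \sum_x p i x = 1) ->
  0 <= mu p i <= 1.
Proof.
move=> D0 p0 p1; have D0R : (0 : R) < D%:R by rewrite ltr0n.
rewrite /mu sumr_ge0 => [|x _]; last by rewrite mulr_ge0 // divr_ge0.
rewrite -[leRHS](p1 i) ler_sum // => x _; rewrite ler_piMr // ler_pdivrMr // mul1r ler_nat.
by rewrite -ltnS.
Qed.

Section Confidence.
Variables (R : realType) (K T D : nat) (ds : seq nat) (Ss : seq {set 'I_K}).
Local Notation S_ := (nth finset.set0 Ss).
Hypothesis nested : forall m, S_ m.+1 \subset S_ m.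
Hypotheses (T2 : (2 <= T)%N) (D0 : (0 < D)%N).
Hypothesis dsD : forall l, (delay ds l <= D)%N.
Local Notation arms_ m := (played (take m Ss)).
Local Notation time_ m := (1 + size (arms_ m))%N.
Local Notation L := (ln T%:R : R).
Local Notation width m := (Num.sqrt (2 * L / m%:R)).
Local Notation reward i c := ((play_delay ds Ss i c)%:R / D%:R : R).

Let L_ge : 2^-1 <= L. Proof. exact: ln_nat_ge_half. Qed.

(** Makes the confidence bounds valid while no feedback is complete. *)
Lemma width1_ge1 : 1 <= width 1.
Proof.
rewrite divr1 -[leLHS]sqrtr1 ler_wsqrtr //; move: L_ge; lra.
Qed.

Lemma width_antitone f m : (0 < f <= m)%N -> width m <= width f.
Proof.
case/andP=> f0 fm; apply: ler_wsqrtr; rewrite ler_wpM2l //; first by move: L_ge; lra.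
by rewrite lef_pV2 ?posrE ?ltr0n ?ler_nat // (leq_trans f0).
Qed.

Section Arm.
Variables (i : 'I_K) (m : nat) (a : R).
Hypothesis a01 : 0 <= a <= 1.
Hypothesis m_plays : (0 < m <= nplays Ss i)%N.
Hypothesis conc : forall n, (0 < n <= nplays Ss i)%N ->
  `|\sum_(0 <= c < n) reward i c - n%:R * a| <= n%:R * width n.
Local Notation f0 := (m.-1 - D %/ #|S_ m.-1|)%N.

Lemma mean_near n : (0 < n <= nplays Ss i)%N ->
  a - width n <= (\sum_(0 <= c < n) reward i c) / n%:R <= a + width n.
Proof.
move=> n_plays; have n0 : (0 : R) < n%:R by rewrite ltr0n; case/andP: n_plays.
rewrite ler_pdivlMr // ler_pdivrMr //.
by have := conc n_plays; rewrite ler_norml => /andP[]; lra.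
Qed.

Lemma delayed_bounds :
  [/\ LCB R T D ds (time_ m) (arms_ m) i <= a, a <= U2 R T D ds (time_ m) (arms_ m) i &
  (0 < f0)%N -> a - 2 * width f0 <= LCB R T D ds (time_ m) (arms_ m) i /\
    U2 R T D ds (time_ m) (arms_ m) i <= a + 2 * width f0].
Proof.
have [f [/andP[f0f fm] cardF sumF]] := Fset_initial R D ds nested m_plays.
rewrite /LCB /U2 /muF /Fcount cardF sumF.
(* With an empty window the mean is 0 and the count defaults to 1; a radius of at least 1 then
   covers [[0, 1]]. *)
have [fz|f_gt0] := posnP f.
  rewrite fz big_geq // mul0r !add0r (maxn_idPr _) //; have := width1_ge1.
  case/andP: a01 => a0 a1 w1; split; [lra|lra|].
  by rewrite ltnNge (leq_trans f0f) // fz.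
rewrite (maxn_idPl _) //.
have f_plays : (0 < f <= nplays Ss i)%N.
  by rewrite f_gt0 (leq_trans fm) //; case/andP: m_plays.
have /andP[lo hi] := mean_near f_plays; split; [lra|lra|] => f0_gt0.
have := @width_antitone f0 f; rewrite f0_gt0 f0f => /(_ isT); lra.
Qed.

Lemma UCB_ge : a <= UCB R T D ds (time_ m) (arms_ m) i.
Proof.
rewrite /UCB le_min; have [_ -> _] := delayed_bounds; rewrite andbT /U1 ncountE //.
have /andP[lo _] := mean_near m_plays.
have := mu_plus_ge R nested m_plays dsD D0; lra.
Qed.

(** Bounds [U1]: the observed rewards sum to at most all rewards, whose mean is within one width of
    [a]; the second width is the radius. *)
Lemma UCB_le_pending : UCB R T D ds (time_ m) (arms_ m) i <=
  (\sum_(0 <= c < m) (#|S_ m.-1| * (m.-1 - c) < play_delay ds Ss i c))%N%:R / m%:R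
  + a + 2 * width m.
Proof.
rewrite /UCB ge_min; apply/orP; left; rewrite /U1 /mu_plus ncountE // mulrDl.
have /andP[_ hi] := mean_near m_plays.
have m0 : (0 : R) < m%:R by rewrite ltr0n; case/andP: m_plays.
have le1 : #|Mset ds (time_ m) (arms_ m) i|%:R / m%:R <=
  (\sum_(0 <= c < m) (#|S_ m.-1| * (m.-1 - c) < play_delay ds Ss i c))%N%:R / m%:R :> R.
  by rewrite ler_pM2r ?invr_gt0 // ler_nat Mset_le.
have le2 := Oset_sum_le R D ds nested m_plays.
rewrite -(ler_pM2r (_ : 0 < m%:R^-1)) ?invr_gt0 // in le2; lra.
Qed.
End Arm.
End Confidence.

(** * Regret of a single run on the good event *)

Section Regret.
Variables (R : realType) (K T D : nat) (p : 'I_K -> 'I_D.+1 -> R) (istar : 'I_K) (B : R).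
Variables (ds : seq nat) (Ss : seq {set 'I_K}).
Local Notation S_ := (nth finset.set0 Ss).
Local Notation arms_ m := (played (take m Ss)).
Local Notation time_ m := (1 + size (arms_ m))%N.
Local Notation L := (ln T%:R : R).
Local Notation width m := (Num.sqrt (2 * L / m%:R)).
Local Notation reward i c := ((play_delay ds Ss i c)%:R / D%:R : R).
Local Notation N := (nplays Ss).

Hypotheses (T2 : (2 <= T)%N) (D0 : (0 < D)%N).
Hypotheses (p0 : forall i x, 0 <= p i x) (p1 : forall i, \sum_x p i x = 1).
Hypothesis best : forall j, j != istar -> mu p j < mu p istar.
Hypothesis B_ge : mustar p istar / 2 <= B.
Hypothesis dsD : forall l, (delay ds l <= D)%N.
Hypothesis start : (0 < size Ss)%N -> S_ 0 = finset.setT.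
Hypothesis next : forall m, (m.+1 < size Ss)%N ->
  S_ m.+1 = survivors T D B ds (time_ m.+1) (arms_ m.+1) (S_ m).

Definition concentrated := forall i m, (0 < m <= N i)%N ->
  `|\sum_(0 <= c < m) reward i c - m%:R * mu p i| <= m%:R * width m.

(** The expected number of pending plays is at most [dval p i / k + 1]. The Chernoff bound at
    parameter 1/2 multiplies it by [(3/4) / (1/2)] and adds [4 L / (1/2)]. *)
Definition few_pending := forall i m k, (0 < m <= N i)%N -> (0 < k <= K)%N ->
  (\sum_(0 <= c < m) (k * (m.-1 - c) < play_delay ds Ss i c))%N%:R <=
  3 / 2 * (dval p i / k%:R + 1) + 8 * L.

Let L_ge : 2^-1 <= L. Proof. exact: ln_nat_ge_half. Qed.

Lemma run_nested m : S_ m.+1 \subset S_ m.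
Proof.
have [lt_m|le_m] := ltnP m.+1 (size Ss); last by rewrite nth_default ?finset.sub0set.
by rewrite next //; apply/fintype.subsetP => j; rewrite inE => /andP[].
Qed.

Let a01 i : 0 <= mu p i <= 1. Proof. exact: mu_bounds. Qed.

Lemma Delta_gt0 i : (0 < Delta p istar i) = (i != istar).
Proof.
rewrite subr_gt0 /mustar; have [->|/best //] := eqVneq i istar; by rewrite ltxx.
Qed.

(** Arm [i], still active in round [m], has passed the test that ends round [m.-1]. *)
Lemma threshold_le_UCB i j m : (0 < m < N i)%N -> j \in S_ m.-1 ->
  Num.max (LCB R T D ds (time_ m) (arms_ m) j) B <= UCB R T D ds (time_ m) (arms_ m) i.
Proof.
case: m => // m /= lt_m jS; have lt_n : (m.+1 < size Ss)%N.
  exact: leq_trans lt_m (nplays_le_size _ _).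
have : i \in S_ m.+1 by rewrite mem_active //; exact: run_nested.
rewrite next // inE => /andP[_ /existsPn/(_ j)].
by rewrite jS /= -leNgt.
Qed.

Section GoodEvent.
Hypotheses (conc : concentrated) (few : few_pending).

(** No lower confidence bound exceeds [mu p istar], which is at most the upper bound of [istar]; so
    only the threshold [B] can have removed the best arm. *)
Lemma best_dropped m : (0 < m < size Ss)%N -> istar \notin S_ m.-1 -> mustar p istar < B.
Proof.
case/andP=> m0 lt_m; rewrite mem_active; last exact: run_nested.
rewrite -leqNgt => le_m.
have N0 : (0 < N istar)%N.
  by rewrite -mem_active ?start ?inE //; [exact: leq_ltn_trans lt_m | exact: run_nested].
have N_plays : (0 < N istar <= N istar)%N by rewrite N0 /=.
have : istar \notin S_ (N istar).-1.+1.
  by rewrite prednK // mem_active ?ltnn //; exact: run_nested.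
have lt_N : ((N istar).-1.+1 < size Ss)%N by rewrite prednK //; lia.
rewrite next // prednK // inE.
have -> : istar \in S_ (N istar).-1 by rewrite mem_active ?prednK //; exact: run_nested.
rewrite negbK => /existsP[j /andP[jS]].
have j_plays : (0 < N istar <= N j)%N.
  move: jS; rewrite mem_active; last exact: run_nested.
  by rewrite prednK // N0.
have U := UCB_ge run_nested T2 D0 dsD (a01 istar) N_plays (@conc istar).
have [Lj _ _] := delayed_bounds run_nested T2 (a01 j) j_plays (@conc j).
have muj : mu p j <= mu p istar.
  by have [->//|/best/ltW] := eqVneq j istar.
rewrite lt_max => /orP[|]; rewrite /mustar; lra.
Qed.

Section SuboptimalArm.
Variables (i : 'I_K) (m : nat).
Hypotheses (i_sub : i != istar) (m_gt0 : (0 < m)%N) (N_i : N i = m.+1).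
Local Notation k := #|S_ m.-1|.
Local Notation gap := (Delta p istar i).

Let m_plays : (0 < m <= N i)%N. Proof. by rewrite m_gt0 N_i /=. Qed.

Let iS : i \in S_ m.-1.
Proof. by rewrite mem_active ?N_i ?prednK // ?leqW //; exact: run_nested. Qed.

Let k_gt0 : (0 < k)%N. Proof. by rewrite card_gt0; apply/set0Pn; exists i. Qed.

(** If [istar] is active, its lower bound is at most the upper bound of [i], so the gap is at most
    [4 * width f]. If it was dropped, [B] exceeds [mustar] and takes the place of that lower bound.
    Squaring gives [16 * 2 L]. *)
Lemma elimination_by_gap : gap ^+ 2 * (m.-1 - D %/ k)%N%:R <= 32 * L.
Proof.
have gap_gt0 : 0 < gap by rewrite Delta_gt0.
set f := (_ - _)%N; have [->|f_gt0] := posnP f; first by rewrite mulr0; move: L_ge; lra.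
have f_gt0R : (0 : R) < f%:R by rewrite ltr0n.
have le_gap : gap <= 4 * width f.
  have [_ _ /(_ f_gt0)[_ hi]] := delayed_bounds run_nested T2 (a01 i) m_plays (@conc i).
  have w0 : 0 <= width f by rewrite sqrtr_ge0.
  have UU : UCB R T D ds (time_ m) (arms_ m) i <= U2 R T D ds (time_ m) (arms_ m) i.
    by rewrite /UCB ge_min lexx orbT.
  have thr j := @threshold_le_UCB i j m.
  rewrite m_gt0 N_i ltnSn in thr.
  have [sS|sS] := boolP (istar \in S_ m.-1).
    have s_plays : (0 < m <= N istar)%N.
      move: sS; rewrite mem_active; last exact: run_nested.
      by rewrite prednK // m_gt0.
    have [_ _ /(_ f_gt0)[lo _]] := delayed_bounds run_nested T2 (a01 istar) s_plays (@conc istar).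
    have := thr istar isT sS; rewrite ge_max => /andP[le1 _].
    rewrite -/f in hi lo; rewrite /Delta /mustar; lra.
  have lt_m : (m < size Ss)%N by rewrite (leq_trans _ (nplays_le_size Ss i)) ?N_i.
  have := @best_dropped m; rewrite m_gt0 lt_m => /(_ isT sS) Bbig.
  have := thr i isT iS; rewrite ge_max => /andP[_ le1].
  rewrite -/f in hi; rewrite /Delta; lra.
have : gap ^+ 2 <= (4 * width f) ^+ 2.
  by rewrite lerXn2r ?nnegrE ?mulr_ge0 ?sqrtr_ge0 // ltW.
rewrite exprMn sqr_sqrtr; last by rewrite divr_ge0 ?ltW //; move: L_ge; lra.
by move=> h; rewrite -ler_pdivlMr //; lra.
Qed.

(** The [m + 1] plays number at most [f + 2 + D / k]; the two extra ones cost [2 L / gap] each, so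
    36 = 32 + 4. *)
Lemma regret_by_gap : m.+1%:R * gap <= 36 * (L / gap) + D%:R * gap / k%:R.
Proof.
have gap_gt0 : 0 < gap by rewrite Delta_gt0.
have kR : (0 : R) < k%:R by rewrite ltr0n.
have gap_le1 : gap <= 1.
  by have /andP[a0 _] := a01 i; have /andP[_ s1] := a01 istar; rewrite /Delta /mustar; lra.
have mle : m%:R <= (m.-1 - D %/ k)%N%:R + 1 + D%:R / k%:R :> R.
  have : (m <= (m.-1 - D %/ k) + 1 + D %/ k)%N by lia.
  rewrite -(ler_nat R) !natrD => /le_trans; apply; rewrite lerD2l.
  by rewrite ler_pdivlMr // -natrM ler_nat leq_divM.
have := elimination_by_gap; set f := (_ - _)%N in mle *; move: f%:R mle => F mle E.
have E' : gap * F <= 32 * (L / gap).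
  by rewrite mulrA ler_pdivlMr // mulrAC -expr2.
have g2 : gap <= 2 * (L / gap).
  rewrite mulrA ler_pdivlMr //; move: L_ge; nra.
rewrite -natr1; have := ler_wpM2l (ltW gap_gt0) mle.
have -> : D%:R * gap / k%:R = gap * (D%:R / k%:R) by rewrite mulrA [gap * _]mulrC.
lra.
Qed.

(** The distance from [mu p i <= s / 6] to [B >= s / 2], with [s] the best mean, must be filled by
    the pending fraction and two widths. As the pending number is bounded, this bounds [m]. *)
Lemma regret_by_threshold : mu p i <= mustar p istar / 6 ->
  m.+1%:R * gap <= 142 * (L / gap) + 6 * dval p i / k%:R.
Proof.
move=> small; have gap_gt0 : 0 < gap by rewrite Delta_gt0.
have kR : (0 : R) < k%:R by rewrite ltr0n.
have mR : (0 : R) < m%:R by rewrite ltr0n.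
have /andP[a0 _] := a01 i; have /andP[s0 s1] := a01 istar.
have k_le : (0 < k <= K)%N by rewrite k_gt0 -[leqRHS]card_ord max_card.
have U := UCB_le_pending run_nested m_plays (@conc i).
have P := few m_plays k_le; move: U P; set X : R := (\sum_(0 <= c < m) _)%N%:R => U P.
have := @threshold_le_UCB i i m; rewrite m_gt0 N_i ltnSn => /(_ isT iS).
rewrite ge_max => /andP[_ Ble].
pose s := mustar p istar; have sE : s = mu p istar by [].
have gapE : gap = s - mu p i by [].
have s_gt0 : 0 < s by move: gap_gt0; rewrite gapE; lra.
have w2 : width m ^+ 2 * m%:R = 2 * L.
  by rewrite sqr_sqrtr ?divfK ?lt0r_neq0 // divr_ge0 ?ltW //; move: L_ge; lra.
(* AM-GM: [2 w <= s / 12 + 12 w^2 / s] *)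
have amgm : 2 * width m * s <= s ^+ 2 / 12 + 12 * width m ^+ 2.
  by have := sqr_ge0 (s / 12 - width m); nra.
have main : s ^+ 2 * m%:R <= 4 * X * s + 96 * L.
  have c1 : s / 3 <= X / m%:R + 2 * width m by rewrite /s; move: Ble U small B_ge; lra.
  have c2 : s ^+ 2 / 4 <= X / m%:R * s + 12 * width m ^+ 2 by nra.
  have := ler_wpM2r (ltW mR) c2.
  have -> : (X / m%:R * s + 12 * width m ^+ 2) * m%:R = X * s + 24 * L.
    by rewrite mulrDl mulrAC divfK ?lt0r_neq0 // -[12 * _ * _]mulrA w2; lra.
  lra.
have main' : s * m%:R <= 4 * X + 96 * (L / s).
  by rewrite -(ler_pM2r s_gt0) mulrDl -!mulrA mulVf ?lt0r_neq0 // mulr1; move: main; lra.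
have Lgap : L / s <= L / gap.
  by rewrite ler_wpM2l ?lef_pV2 ?posrE ?gapE //; move: L_ge; lra.
have Lge : L <= L / gap by rewrite ler_pdivlMr // ler_piMr; move: L_ge; lra.
have gm : m.+1%:R * gap <= s * m%:R + s.
  rewrite -natr1 mulrDl mul1r lerD //; last by rewrite gapE; lra.
  by rewrite mulrC ler_wpM2r // ?gapE; lra.
have -> : 6 * dval p i / k%:R = 6 * (dval p i / k%:R) by rewrite mulrA.
(* The constant is 142 = 96 + 32 + 14: 96 from the widths, [32 L] from [4 X], and the constants 6
   from [4 X] and [s <= 1], together at most [14 L]. *)
move: P gm main' Lgap Lge L_ge s1; rewrite -sE; move: (L / gap) (L / s) (dval p i / k%:R) => b c d. lra.
Qed.
End SuboptimalArm.
End GoodEvent.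

(** * Summing the regret over the arms *)

Local Notation cost := (Num.min (dbar p istar) (D%:R * Deltamax p istar)).

Lemma cost_ge0 : 0 <= cost.
Proof.
have max_ge0 (I : finType) (P : pred I) (F : I -> R) : 0 <= \big[Num.max/0]_(i | P i) F i.
  by elim/big_rec: _ => // i x _ x0; rewrite le_max x0 orbT.
by rewrite le_min /dbar max_ge0 mulr_ge0 // /Deltamax max_ge0.
Qed.

Lemma arm_regret_le i : (size Ss <= 1)%N \/ concentrated /\ few_pending -> i != istar ->
  Delta p istar i *+ N i <= 142 * (L / Delta p istar i) +
    6 * cost * #|[set j in finset.setC [set istar] | (N i <= N j)%N]|%:R^-1.
Proof.
move=> good i_sub; have gap_gt0 : 0 < Delta p istar i by rewrite Delta_gt0.
have /andP[a0 _] := a01 i; have /andP[s0 s1] := a01 istar.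
have gap_le1 : Delta p istar i <= 1 by rewrite /Delta /mustar; lra.
set r := #|_|; have r_gt0 : (0 < r)%N.
  by rewrite card_gt0; apply/set0Pn; exists i; rewrite !inE i_sub /=.
have rR : (0 : R) < r%:R by rewrite ltr0n.
have cost_r : 0 <= 6 * cost * r%:R^-1 by rewrite mulr_ge0 ?invr_ge0 // mulr_ge0 // cost_ge0.
have g2 : Delta p istar i <= 2 * (L / Delta p istar i).
  by rewrite mulrA ler_pdivlMr //; move: L_ge; nra.
have Lg0 : 0 <= L / Delta p istar i by rewrite divr_ge0 ?ltW //; move: L_ge; lra.
case: (leqP (N i) 1) => [N1|N2].
  apply: le_trans (_ : Delta p istar i <= _); last by lra.
  by case: (N i) N1 => [|[|]] //; rewrite mulr0n ltW.
case: good => [n1|[conc few]]; first by rewrite ltnNge (leq_trans (nplays_le_size Ss i) n1) in N2.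
have m_gt0 : (0 < (N i).-1)%N by case: (N i) N2 => [|[]].
have N_i : N i = (N i).-1.+1 by rewrite prednK // ltnW.
set m := (N i).-1 in m_gt0 N_i.
(* Every arm played at least as often as [i] is still active in round [m.-1]. *)
have r_le : (r <= #|S_ m.-1|)%N.
  apply: subset_leq_card; apply/fintype.subsetP => j; rewrite inE => /andP[_ le_j].
  rewrite mem_active; last exact: run_nested.
  by rewrite (leq_trans _ le_j) // N_i ltnS leq_pred.
have kR : (0 : R) < #|S_ m.-1|%:R by rewrite ltr0n (leq_trans r_gt0).
have kr (x y : R) : 0 <= x -> x <= y -> x / #|S_ m.-1|%:R <= y * r%:R^-1.
  move=> x0 xy; apply: (@le_trans _ _ (x / r%:R)).
    by rewrite ler_wpM2l // lef_pV2 ?posrE // ler_nat.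
  by rewrite ler_wpM2r // invr_ge0 ltW.
have D0R : (0 : R) < D%:R by rewrite ltr0n.
have by_gap := regret_by_gap conc i_sub m_gt0 N_i.
have by_threshold := regret_by_threshold conc few i_sub m_gt0 N_i.
rewrite -[_ *+ N i]mulr_natl N_i.
have Dgap0 : 0 <= D%:R * Delta p istar i by rewrite mulr_ge0 // ltW.
have use_gap : D%:R * Delta p istar i <= 6 * cost -> m.+1%:R * Delta p istar i <=
    142 * (L / Delta p istar i) + 6 * cost * r%:R^-1.
  by move=> /(kr _ _ Dgap0); lra.
have [le_c|/ltW le_c] := leP (D%:R * Deltamax p istar) (dbar p istar).
  move: use_gap; rewrite min_r //; apply.
  have : Delta p istar i <= Deltamax p istar by rewrite /Deltamax (bigD1 i) //= le_max lexx.
  by move: Dgap0; nra.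
have d_le : dval p i <= dbar p istar by rewrite /dbar (bigD1 i) //= le_max lexx.
move: use_gap; rewrite min_l // => use_gap.
(* Either [D * Delta <= D * mustar <= 6 * dbar] and the gap bound suffices, or [mu p i] is so small
   that the threshold bound applies. *)
have [near|far] := leP (D%:R * mustar p istar) (6 * dbar p istar).
  apply: use_gap; apply: le_trans near.
  by rewrite ler_pM2l // /Delta; lra.
have small : mu p i <= mustar p istar / 6.
  rewrite -(ler_pM2l D0R); move: d_le; rewrite /dval; lra.
have d0 : 0 <= 6 * dval p i by rewrite mulr_ge0 // mulr_ge0.
have := kr _ _ d0 (ler_wpM2l (_ : 0 <= 6) d_le); rewrite ler0n => /(_ isT).
by have := by_threshold small; lra.
Qed.

Lemma run_regret_le : (size Ss <= 1)%N \/ concentrated /\ few_pending ->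
  \sum_(a <- played Ss) Delta p istar a <=
  \sum_(i < K | 0 < Delta p istar i) (142 * (L / Delta p istar i)) + 12 * cost * ln K%:R.
Proof.
move=> good; rewrite (sum_played run_nested).
rewrite (bigD1 istar) //= {1}/Delta subrr mul0rn add0r.
rewrite (eq_bigl _ _ Delta_gt0).
apply: le_trans (ler_sum _ (fun i => arm_regret_le good)) _.
rewrite big_split lerD2l /= -mulr_sumr.
have K_gt0 : (0 < K)%N by case: (K) istar => // -[].
have cardA : #|finset.setC [set istar]| = K.-1 by rewrite cardsC1 card_ord.
have rank : \sum_(i | i != istar)
    (#|[set j in finset.setC [set istar] | (N i <= N j)%N]|%:R^-1 : R) <= 2 * ln K%:R.
  have := sum_inv_rank_le R (finset.setC [set istar]) N.
  rewrite cardA (eq_bigl (fun i => i != istar)); last by move=> i; rewrite !inE.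
  by move/le_trans; apply; have := harmonic_le_ln R K.-1; rewrite prednK.
have := ler_wpM2l (_ : 0 <= 6 * cost) rank; rewrite mulr_ge0 ?cost_ge0 // => /(_ isT).
lra.
Qed.
End Regret.

(** * Supermartingales along the run *)

Lemma count_mul_lt_le (k x m : nat) : (0 < k)%N ->
  (\sum_(0 <= j < m) (k * j < x) <= x %/ k + 1)%N.
Proof.
move=> k0; apply: (@leq_trans (\sum_(0 <= j < m) (j < x %/ k + 1))%N).
  apply: leq_sum => j _; case: ltnP => // lt_x.
  by rewrite addn1 ltnS leq_divRL // [(j * k)%N]mulnC (ltnW lt_x).
elim: m => [|m IH]; first by rewrite big_geq.
move: (x %/ k + 1)%N IH => b IH; rewrite big_nat_recr //=.
have [lt_m|le_b] := ltnP m b; last by rewrite addn0.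
rewrite addn1; apply: leq_ltn_trans lt_m.
rewrite -[leqRHS]subn0 -[leqRHS]muln1 -sum_nat_const_nat.
by apply: leq_sum => j _; case: (_ < _)%N.
Qed.

Section Measure.
Variables (R : realType) (K T D : nat) (p : 'I_K -> 'I_D.+1 -> R) (istar : 'I_K) (B : R).
Hypotheses (p0 : forall i x, 0 <= p i x) (p1 : forall i, \sum_x p i x = 1).
Hypotheses (T2 : (2 <= T)%N) (D0 : (0 < D)%N).
Local Notation L := (ln T%:R : R).
Local Notation width m := (Num.sqrt (2 * L / m%:R)).

Definition run (s : seq nat) : seq 'I_K :=
  rse_arms T D B s T 1 (finset.setT : {set 'I_K}) [::].

(** Replays the run on the history [s]; missing delays read as 0, which cannot affect step
    [size s]. *)
Definition next_arm (s : seq nat) : 'I_K := nth istar (run s) (size s).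

Definition plays_before (i : 'I_K) (s : seq nat) : nat :=
  (\sum_(0 <= l < size s) (next_arm (take l s) == i))%N.

Definition delays (w : {ffun 'I_(T + K) -> 'I_D.+1}) : seq nat :=
  [seq nat_of_ord (w j) | j <- enum 'I_(T + K)].

Definition run_probability (w : {ffun 'I_(T + K) -> 'I_D.+1}) : R :=
  \prod_(j < T + K) p (nth istar (run (delays w)) j) (w j).

(* Multiplied along the run, these give the product of [h c] (delay of the [c]-th play of [i]) over [c < m]. *)
Definition arm_weight (i : 'I_K) (m : nat) (h : nat -> nat -> R) (s : seq nat) (x : nat) : R :=
  if (next_arm s == i) && (plays_before i s < m)%N then h (plays_before i s) x else 1.

Definition run_weight i m h (w : {ffun 'I_(T + K) -> 'I_D.+1}) : R :=
  \prod_(j < T + K) arm_weight i m h (take j (delays w)) (w j).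

Lemma size_delays w : size (delays w) = (T + K)%N.
Proof. by rewrite size_map size_enum_ord. Qed.

Lemma nth_delays w (j : 'I_(T + K)) : nth 0%N (delays w) j = w j.
Proof. by rewrite (nth_map j) ?size_enum_ord // nth_ord_enum. Qed.

Lemma delay_le w l : (delay (delays w) l <= D)%N.
Proof.
rewrite /delay; have [lt_l|le_l] := ltnP l (T + K).
  by rewrite (nth_delays w (Ordinal lt_l)) -ltnS.
by rewrite nth_default // size_delays.
Qed.

Lemma next_armE w j : (j <= T + K)%N ->
  next_arm (take j (delays w)) = nth istar (run (delays w)) j.
Proof.
move=> le_j; rewrite /next_arm size_take_min size_delays (minn_idPl le_j).
apply: rse_arms_nonanticipating => l lt_l; exact: nth_take.
Qed.

Lemma plays_beforeE i w j : (j <= T + K)%N ->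
  plays_before i (take j (delays w)) =
  (\sum_(0 <= l < j) (nth istar (run (delays w)) l == i))%N.
Proof.
move=> le_j; rewrite /plays_before size_take_min size_delays (minn_idPl le_j).
apply: eq_big_nat => l /andP[_ lt_l].
by rewrite take_takel ?(ltnW lt_l) // next_armE // (leq_trans (ltnW lt_l)).
Qed.

(** At each step the weight is either a factor [h c] averaged under the law of [i], or 1, so the
    weighted kernel has mass at most 1. *)
Lemma expected_weight_le1 i m (h : nat -> nat -> R) :
  (forall c x, 0 <= h c x) -> (forall c, \sum_x p i x * h c x <= 1) ->
  \sum_w run_probability w * run_weight i m h w <= 1.
Proof.
move=> h0 h1.
pose q s (x : 'I_D.+1) := p (next_arm s) x * arm_weight i m h s x.
have w0 s (x : 'I_D.+1) : 0 <= arm_weight i m h s x.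
  by rewrite /arm_weight; case: ifP.
have := @adaptive_mass_le1 R 'I_D.+1 (@nat_of_ord _) (T + K) q.
rewrite (_ : \sum_w _ = \sum_w run_probability w * run_weight i m h w).
  apply=> [s x|s]; first by rewrite mulr_ge0.
  rewrite /q /arm_weight; have [/andP[/eqP -> _]|_] := boolP (_ && _); first exact: h1.
  by under eq_bigr do rewrite mulr1; rewrite p1.
apply: eq_bigr => w _; rewrite /run_probability /run_weight -big_split /=.
by apply: eq_bigr => j _; rewrite /q /= next_armE // ltnW.
Qed.

Lemma total_probability_le1 : \sum_w run_probability w <= 1.
Proof.
have := @expected_weight_le1 istar 0 (fun _ _ => 1).
rewrite (eq_bigr run_probability).
  by apply=> [c x|c] //; under eq_bigr do rewrite mulr1; rewrite p1.
move=> w _; rewrite /run_weight big1 ?mulr1 // => j _.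
by rewrite /arm_weight ltn0 andbF.
Qed.

Section Trace.
Variables (w : {ffun 'I_(T + K) -> 'I_D.+1}) (Ss : seq {set 'I_K}).
Local Notation S_ := (nth finset.set0 Ss).
Hypothesis nested : forall m, S_ m.+1 \subset S_ m.
Hypothesis runE : run (delays w) = played Ss.
Hypothesis time : forall m, (m < size Ss)%N -> (1 + size (played (take m Ss)) < T)%N.

(** The last round starts before [T] and has at most [K] steps. *)
Lemma size_run_le : (size (played Ss) <= T + K)%N.
Proof.
case: (posnP (size Ss)) => [/size0nil ->//|n0].
have lt_n : ((size Ss).-1 < size Ss)%N by rewrite prednK.
have := size_playedS lt_n; rewrite prednK // take_size => ->.
apply: leq_add; first by have := time lt_n; rewrite add1n => /ltnW/ltnW.
by rewrite -[leqRHS]card_ord max_card.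
Qed.

Lemma le_size_played i m : (m <= nplays Ss i)%N -> (m <= size (played (take m Ss)))%N.
Proof.
elim: m => // m IH lt_m.
rewrite size_playedS; last exact: leq_trans lt_m (nplays_le_size _ _).
rewrite -addn1 leq_add ?IH ?(ltnW lt_m) // card_gt0.
by apply/set0Pn; exists i; rewrite mem_active.
Qed.

Lemma nplays_lt i : (nplays Ss i < T)%N.
Proof.
case E : (nplays Ss i) => [|n]; first exact: leq_trans T2.
have lt_n : (n < size Ss)%N by rewrite (leq_trans _ (nplays_le_size Ss i)) ?E.
apply: leq_ltn_trans (time lt_n).
by rewrite add1n ltnS (@le_size_played i) // E.
Qed.

Lemma run_weightE i m h : (m <= nplays Ss i)%N ->
  run_weight i m h w = \prod_(0 <= c < m) h c (play_delay (delays w) Ss i c).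
Proof.
move=> le_m.
pose cnt j := (\sum_(0 <= l < j) (nth istar (played Ss) l == i))%N.
pose G j := if (cnt j < m)%N then h (cnt j) (delay (delays w) j) else 1.
have -> : run_weight i m h w =
    \prod_(0 <= j < T + K) (if nth istar (played Ss) j == i then G j else 1).
  rewrite big_mkord; apply: eq_bigr => j _.
  have le_j := ltnW (ltn_ord j).
  rewrite /arm_weight next_armE // plays_beforeE // runE -/(cnt j) /G /delay nth_delays.
  by case: (_ == _).
rewrite (big_cat_nat (n := size (played Ss))) ?size_run_le //=.
(* Dummy draws after the run look like plays of [istar], but the count has then reached [m] and
   their weight is 1. *)
rewrite [X in _ * X]big_nat_cond [X in _ * X]big1 ?mulr1; last first.
  move=> j /andP[/andP[le_j _] _]; case: ifP => // _; rewrite /G ltnNge.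
  by rewrite (leq_trans le_m) // count_played_ge.
have := big_played *%R istar i G (leqnn (size Ss)).
rewrite take_size big_mkcond /= => ->.
rewrite (big_cat_nat (n := nplays Ss i)) ?nplays_le_size //=.
rewrite [X in _ * X]big_nat_cond [X in _ * X]big1 ?mulr1; last first.
  by move=> c /andP[/andP[le_c _]]; rewrite mem_active // ltnNge le_c.
rewrite big_active // (big_cat_nat (n := m)) //=.
rewrite [X in _ * X]big_nat_cond [X in _ * X]big1 ?mulr1; last first.
  move=> c /andP[/andP[le_c lt_c] _].
  by rewrite /G /cnt count_before_position // ltnNge le_c.
apply: eq_big_nat => c /andP[_ lt_c].
by rewrite /G /cnt count_before_position ?(leq_trans lt_c) // lt_c.
Qed.
End Trace.

(** * Exponential factors for the two kinds of failure *)

Definition mean_factor (i : 'I_K) (l : R) (_ x : nat) : R :=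
  expR (l * (x%:R / D%:R - mu p i) - l ^+ 2 / 8).

Definition tail (i : 'I_K) (n : nat) : R := \sum_(x : 'I_D.+1 | (n < x)%N) p i x.

Definition pending_factor (i : 'I_K) (k m c x : nat) : R :=
  expR (2^-1 * (k * (m.-1 - c) < x)%N%:R - 3 / 4 * tail i (k * (m.-1 - c))).

Lemma mean_factor_mgf i l c : \sum_x p i x * mean_factor i l c x <= 1.
Proof.
apply: (@hoeffding_mgf R 'I_D.+1 (p i) (fun x => x%:R / D%:R)) => // x.
rewrite divr_ge0 //= ler_pdivrMr ?ltr0n // mul1r ler_nat -ltnS; exact: ltn_ord.
Qed.

Lemma pending_factor_mgf i k m c : \sum_x p i x * pending_factor i k m c x <= 1.
Proof. exact: (@indicator_mgf R 'I_D.+1 (p i) (fun x => (k * (m.-1 - c) < x)%N)). Qed.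

(** Exchanging the sums, a delay [x] is counted once for each age [j] with [k * j < x], at most
    [x / k + 1] times; the expectation is then taken. *)
Lemma sum_tail_le i k m : (0 < k)%N ->
  \sum_(0 <= c < m) tail i (k * (m.-1 - c)) <= dval p i / k%:R + 1.
Proof.
move=> k0; have kR : (0 : R) < k%:R by rewrite ltr0n.
have D0R : (0 : R) < D%:R by rewrite ltr0n.
have -> : dval p i / k%:R + 1 = \sum_x p i x * (x%:R / k%:R + 1).
  under eq_bigr do rewrite mulrDr mulr1.
  rewrite big_split /= p1; congr (_ + _); rewrite /dval /mu mulr_sumr mulr_suml.
  by apply: eq_bigr => x _; field; rewrite !lt0r_neq0.
have -> : \sum_(0 <= c < m) tail i (k * (m.-1 - c)) =
    \sum_x p i x * (\sum_(0 <= c < m) (k * c < x))%N%:R.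
  (* After reversal [c] is the age of a play in rounds. *)
  rewrite big_nat_rev /=.
  transitivity (\sum_(0 <= c < m) \sum_(x : 'I_D.+1) p i x * (k * c < x)%N%:R).
    apply: eq_big_nat => c /andP[_ lt_c]; rewrite /tail big_mkcond /=.
    have -> : (m.-1 - (0 + m - c.+1) = c)%N by case: (m) lt_c => // m'; lia.
    by apply: eq_bigr => x _; case: ifP; rewrite ?mulr1 ?mulr0.
  rewrite exchange_big; apply: eq_bigr => x _.
  by rewrite natr_sum mulr_sumr.
apply: ler_sum => x _; rewrite ler_wpM2l //.
apply: (@le_trans _ _ (x %/ k + 1)%N%:R); first by rewrite ler_nat count_mul_lt_le.
by rewrite natrD lerD2r ler_pdivlMr // -natrM ler_nat leq_divM.
Qed.

Let L_ge : 2^-1 <= L. Proof. exact: ln_nat_ge_half. Qed.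

(** With [l = 4 * width m] the exponent exceeds [4 m w^2 - 2 m w^2 = 4 L], as [m w^2 = 2 L]. The
    sign [b] selects the side of the deviation. *)
Lemma mean_deviation_weight_ge (i : 'I_K) (m : nat) (y : nat -> nat) (b : bool) : (0 < m)%N ->
  let dev := \sum_(0 <= c < m) (y c)%:R / D%:R - m%:R * mu p i in
  m%:R * width m < (-1) ^+ b * dev ->
  expR (4 * L) <= \prod_(0 <= c < m) mean_factor i ((-1) ^+ b * (4 * width m)) c (y c).
Proof.
move=> m0 dev lt_dev; have mR : (0 : R) < m%:R by rewrite ltr0n.
rewrite /mean_factor -expR_sum ler_expR sumrB -mulr_sumr sumrB !sumr_const_nat !subn0.
rewrite -[mu p i *+ m]mulr_natl -/dev -[_ / 8 *+ m]mulr_natl.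
have w2 : width m ^+ 2 * m%:R = 2 * L.
  by rewrite sqr_sqrtr ?divfK ?lt0r_neq0 // divr_ge0 ?ltW //; move: L_ge; lra.
have w0 : 0 <= width m by rewrite sqrtr_ge0.
rewrite exprMn sqrr_sign mul1r.
move: (width m) w0 w2 lt_dev => v v0 v2 lt_dev.
have : 4 * v * (m%:R * v) <= 4 * v * ((-1) ^+ b * dev).
  by rewrite ler_wpM2l ?mulr_ge0 // ltW.
move: dev lt_dev ((-1) ^+ b) => dev _ s; lra.
Qed.

Lemma pending_excess_weight_ge (i : 'I_K) (k m : nat) (y : nat -> nat) : (0 < k)%N ->
  3 / 2 * (dval p i / k%:R + 1) + 8 * L <
    (\sum_(0 <= c < m) (k * (m.-1 - c) < y c))%N%:R ->
  expR (4 * L) <= \prod_(0 <= c < m) pending_factor i k m c (y c).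
Proof.
move=> k0; rewrite natr_sum => lt_X.
rewrite /pending_factor -expR_sum ler_expR sumrB -!mulr_sumr.
have := sum_tail_le i m k0; lra.
Qed.
End Measure.

(** * Union bound and expected regret *)

Section UnionBound.
Variables (R : realType) (K T D : nat) (p : 'I_K -> 'I_D.+1 -> R) (istar : 'I_K) (B : R).
Hypotheses (D0 : (0 < D)%N) (p0 : forall i x, 0 <= p i x).
Hypothesis p1 : forall i, \sum_x p i x = 1.
Hypothesis best : forall j, j != istar -> mu p j < mu p istar.
Hypothesis B_ge : mustar p istar / 2 <= B.
Hypothesis T2 : (2 <= T)%N.
Local Notation L := (ln T%:R : R).
Local Notation width m := (Num.sqrt (2 * L / m%:R)).
Local Notation delays := (@delays K T D).
Local Notation run := (@run R K T D B).
Local Notation cost := (Num.min (dbar p istar) (D%:R * Deltamax p istar)).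
Local Notation good_bound :=
  (\sum_(i < K | 0 < Delta p istar i) (142 * (L / Delta p istar i)) + 12 * cost * ln K%:R).
Local Notation event := ('I_K * 'I_T * (bool + 'I_K))%type.

(** An event [(i, m, _)] concerns the first [m + 1] plays of [i]: [inl b] is a deviation of the mean
    to one side, [inr k] an excess of pending plays at rate [k + 1]. The shifts come from ordinals
    starting at 0. *)
Definition event_factor (e : event) : nat -> nat -> R :=
  match e.2 with
  | inl b => mean_factor p e.1.1 ((-1) ^+ b * (4 * width e.1.2.+1))
  | inr k => pending_factor p e.1.1 k.+1 e.1.2.+1
  end.

Definition event_weight (e : event) : {ffun 'I_(T + K) -> 'I_D.+1} -> R :=
  run_weight istar B e.1.1 e.1.2.+1 (event_factor e).

Lemma event_factor_ge0 e c x : 0 <= event_factor e c x.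
Proof. by case: e => [[i m] [b|k]]; apply: expR_ge0. Qed.

Lemma event_weight_ge0 e w : 0 <= event_weight e w.
Proof.
apply: prodr_ge0 => j _; rewrite /arm_weight; case: ifP => // _.
exact: event_factor_ge0.
Qed.

Lemma expected_event_weight e :
  \sum_w run_probability p istar B w * event_weight e w <= 1.
Proof.
apply: expected_weight_le1 => // [c x|c]; first exact: event_factor_ge0.
case: e => [[i m] [b|k]]; [exact: mean_factor_mgf|exact: pending_factor_mgf].
Qed.

Lemma trace_exists w : exists Ss : seq {set 'I_K},
  [/\ run (delays w) = played Ss,
      (0 < size Ss)%N -> nth finset.set0 Ss 0 = finset.setT,
      forall m, (m < size Ss)%N -> (1 + size (played (take m Ss)) < T)%N &
      forall m, (m.+1 < size Ss)%N -> nth finset.set0 Ss m.+1 =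
        survivors T D B (delays w) (1 + size (played (take m.+1 Ss)))
          (played (take m.+1 Ss)) (nth finset.set0 Ss m)].
Proof.
by apply: (@rse_trace R K T D B (delays w) T 1 finset.setT [::]); apply/set0Pn; exists istar.
Qed.

Lemma Deltamax_ge0 : 0 <= Deltamax p istar.
Proof.
by rewrite /Deltamax; elim/big_rec: _ => // i x _ x0; rewrite le_max x0 orbT.
Qed.

Lemma Delta_le_max i : Delta p istar i <= Deltamax p istar.
Proof. by rewrite /Deltamax (bigD1 i) //= le_max lexx. Qed.

Lemma ln_ratio_ge0 i : 0 < Delta p istar i -> 0 <= L / Delta p istar i.
Proof. by move=> di; apply: divr_ge0 (ltW di); rewrite ln_ge0 // ler1n ltnW. Qed.

Lemma good_bound_ge0 : 0 <= good_bound.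
Proof.
apply: addr_ge0; first by apply: sumr_ge0 => i di; rewrite mulr_ge0 ?ln_ratio_ge0.
rewrite mulr_ge0 ?mulr_ge0 ?cost_ge0 ?ln_ge0 // ler1n.
exact: leq_ltn_trans (leq0n _) (ltn_ord istar).
Qed.

(** Markov's inequality along each run: if some event fails, its weight is at least [T^4], so the
    sum of all weights over [T^4] dominates the indicator of failure; a failing run costs at most
    [(T + K) * Deltamax]. *)
Lemma regret_pointwise w :
  \sum_(a <- run (delays w)) Delta p istar a <= good_bound +
    (if (K < T)%N then (T + K)%:R * Deltamax p istar / T%:R ^+ 4 *
      \sum_e event_weight e w else 0).
Proof.
have [Ss [runE start time next]] := trace_exists w.
have nested := run_nested next.
have dsD := delay_le w.
have regret := run_regret_le T2 D0 p0 p1 best B_ge dsD start next.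
rewrite runE; case: ifP => [KT|/negbT]; last first.
  (* When [K >= T], the first round already plays [K] steps and no second one starts. *)
  rewrite -leqNgt addr0 => TK; apply: regret; left.
  rewrite leqNgt; apply/negP => n1; have := time 1%N n1.
  rewrite size_playedS ?(ltnW n1) // take0 start ?(ltnW n1) // cardsT card_ord.
  by rewrite add0n add1n ltnNge (leq_trans TK).
have TR : (0 : R) < T%:R by rewrite ltr0n ltnW.
have e4L : expR (4 * L) = T%:R ^+ 4 by rewrite expRM_natl lnK.
have sum_ge0 : 0 <= \sum_e event_weight e w.
  by apply: sumr_ge0 => e _; exact: event_weight_ge0.
have W_ge0 : 0 <= (T + K)%:R * Deltamax p istar / T%:R ^+ 4.
  by rewrite divr_ge0 ?exprn_ge0 // mulr_ge0 // Deltamax_ge0.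
have lt_plays i : (nplays Ss i < T)%N by exact: (nplays_lt T2 nested time).
have [/existsP[e big_e]|/existsPn small] := boolP [exists e, T%:R ^+ 4 <= event_weight e w].
  have good0 := good_bound_ge0.
  apply: (@le_trans _ _ ((T + K)%:R * Deltamax p istar)).
    apply: (@le_trans _ _ (\sum_(a <- played Ss) Deltamax p istar)).
      by apply: ler_sum => a _; exact: Delta_le_max.
    rewrite big_const_seq count_predT iter_addr_0 -[_ *+ size _]mulr_natl.
    rewrite ler_wpM2r ?Deltamax_ge0 // ler_nat.
    by apply: size_run_le.
  apply: (@le_trans _ _ ((T + K)%:R * Deltamax p istar / T%:R ^+ 4 * \sum_e event_weight e w)).
    rewrite -[leLHS](divfK (lt0r_neq0 (exprn_gt0 4 TR))) ler_wpM2l //.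
    apply: le_trans big_e _; rewrite (bigD1 e) //= lerDl.
    by apply: sumr_ge0 => ? _; exact: event_weight_ge0.
  by rewrite lerDr.
apply: ler_wpDr; first exact: mulr_ge0.
apply: regret; right; split.
  move=> i m /andP[m0 le_m]; rewrite leNgt ltr_normr; apply/negP => dev.
  have lt_m : (m.-1 < T)%N by rewrite (leq_ltn_trans (leq_pred m)) // (leq_ltn_trans le_m).
  pose b := ~~ (m%:R * width m <
    \sum_(0 <= c < m) (play_delay (delays w) Ss i c)%:R / D%:R - m%:R * mu p i).
  have := small (i, Ordinal lt_m, inl b); rewrite -e4L /event_weight /event_factor /= prednK //.
  rewrite (run_weightE istar nested runE time) // mean_deviation_weight_ge //.
  move: dev; rewrite /b; case: ltP => /= [?|_]; first by rewrite expr0 mul1r.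
  by rewrite expr1 mulN1r.
move=> i m k /andP[m0 le_m] /andP[k0 le_k]; rewrite leNgt; apply/negP => many.
have lt_m : (m.-1 < T)%N by rewrite (leq_ltn_trans (leq_pred m)) // (leq_ltn_trans le_m).
have lt_k : (k.-1 < K)%N by rewrite prednK.
have := small (i, Ordinal lt_m, inr (Ordinal lt_k)).
rewrite -e4L /event_weight /event_factor /= !prednK //.
by rewrite (run_weightE istar nested runE time) // pending_excess_weight_ge.
Qed.

(** A positive gap [d] satisfies [d^2 <= 1 <= 2 L]. The failure cost [4 * Deltamax] thus raises 142
    to 150. *)
Lemma Deltamax_le : Deltamax p istar <=
  \sum_(i < K | 0 < Delta p istar i) (2 * (L / Delta p istar i)).
Proof.
have L_ge := ln_nat_ge_half R T2.
have term_ge0 i : 0 < Delta p istar i -> 0 <= 2 * (L / Delta p istar i).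
  by move=> di; rewrite mulr_ge0 ?ln_ratio_ge0.
have sum_ge0 : 0 <= \sum_(i < K | 0 < Delta p istar i) (2 * (L / Delta p istar i)).
  exact: sumr_ge0.
rewrite {1}/Deltamax; elim/big_ind: _ => // [x y x_le y_le|i _]; first by rewrite ge_max x_le.
have [di|/le_trans] := ltP 0 (Delta p istar i); last exact.
rewrite (bigD1 i) //=; apply: ler_wpDr; first by apply: sumr_ge0 => j /andP[/term_ge0].
have /andP[_ s1] := mu_bounds istar D0 p0 p1; have /andP[a0 _] := mu_bounds i D0 p0 p1.
have d1 : Delta p istar i <= 1 by rewrite /Delta /mustar; lra.
rewrite mulrA ler_pdivlMr //; nra.
Qed.

(** Since [K < T], the factors [T + K] and [K + 2] are at most [2 T], and
    [2 T * K * T * 2 T <= 4 T^4]. *)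
Lemma failure_mass : (K < T)%N ->
  (T + K)%:R / T%:R ^+ 4 * #|{: event}|%:R <= 4 :> R.
Proof.
move=> KT; have TR : (0 : R) < T%:R ^+ 4 by rewrite exprn_gt0 // ltr0n ltnW.
rewrite mulrAC ler_pdivrMr // !card_prod card_sum card_bool !card_ord.
rewrite -natrX -!natrM ler_nat.
have h1 : (T + K <= 2 * T)%N by rewrite mul2n -addnn leq_add2l ltnW.
have h2 : (2 + K <= 2 * T)%N by rewrite mul2n -addnn leq_add // ltnW.
apply: leq_trans (leq_mul h1 (leq_mul (leq_mul (ltnW KT) (leqnn T)) h2)) _.
by rewrite (_ : 2 * T * (T * T * (2 * T)) = 4 * T ^ 4)%N //; lia.
Qed.

Lemma regret_le : @rse_regret R K T D p istar B <=
  \sum_(i < K | 0 < Delta p istar i) (150 * (L / Delta p istar i)) + 12 * cost * ln K%:R.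
Proof.
have pr0 w : 0 <= run_probability p istar B w by apply: prodr_ge0 => j _.
have L_ge := ln_nat_ge_half R T2.
have good0 := good_bound_ge0.
set W := (T + K)%:R * Deltamax p istar / T%:R ^+ 4.
have W_ge0 : 0 <= W by rewrite divr_ge0 ?exprn_ge0 // mulr_ge0 // Deltamax_ge0.
apply: (@le_trans _ _ (good_bound + 4 * Deltamax p istar)); last first.
  have := Deltamax_le; rewrite -!mulr_sumr; move: (\sum_(i | _) _) => S; lra.
apply: (@le_trans _ _ (\sum_w run_probability p istar B w * (good_bound +
    (if (K < T)%N then W * \sum_e event_weight e w else 0)))).
  by apply: ler_sum => w _; apply: ler_wpM2l; [exact: pr0|exact: regret_pointwise].
under eq_bigr do rewrite mulrDr.
rewrite big_split /= -mulr_suml; apply: lerD.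
  by rewrite ler_piMl // total_probability_le1.
case KT : (K < T)%N; last by rewrite big1 ?mulr_ge0 ?Deltamax_ge0 // => w _; rewrite mulr0.
have -> : \sum_w run_probability p istar B w * (W * \sum_e event_weight e w) =
    W * \sum_e \sum_w run_probability p istar B w * event_weight e w.
  rewrite exchange_big mulr_sumr; apply: eq_bigr => w _.
  by rewrite mulrCA mulr_sumr.
apply: (@le_trans _ _ (W * #|{: event}|%:R)).
  rewrite ler_wpM2l // -sum1_card natr_sum; apply: ler_sum => e _.
  exact: expected_event_weight.
have := ler_wpM2r Deltamax_ge0 (failure_mass KT); rewrite /W.
by apply: le_trans; rewrite le_eqVlt; apply/orP; left; apply/eqP; ring.
Qed.
End UnionBound.

Theorem theorem4 (R : realType) (K T D : nat)
  (p : 'I_K -> 'I_D.+1 -> R) (istar : 'I_K) (B : R) :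
  (0 < D)%N ->
  (forall i x, 0 <= p i x) ->
  (forall i, \sum_(x < D.+1) p i x = 1) ->
  (forall j, j != istar -> mu p j < mu p istar) ->
  mustar p istar / 2 <= B ->
  @rse_regret R K T D p istar B <=
    \sum_(i < K | 0 < Delta p istar i) (289 * ln T%:R / Delta p istar i)
    + 12 * Num.min (dbar p istar) (D%:R * Deltamax p istar) * ln K%:R.
Proof.
move=> D0 p0 p1 best B_ge.
have K_gt0 : (0 < K)%N := leq_ltn_trans (leq0n _) (ltn_ord istar).
have tail0 : 0 <= 12 * Num.min (dbar p istar) (D%:R * Deltamax p istar) * ln K%:R.
  by rewrite mulr_ge0 ?mulr_ge0 ?cost_ge0 ?ln_ge0 ?ler1n.
(* For [T <= 1] no round starts, as time begins at 1, and [ln T] is 0, with [ln 0 = 0] by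
   convention. *)
have [T2|T1] := leqP 2 T; last first.
  have L0 : ln T%:R = 0 :> R.
    by case: T T1 => [|[|]] // _; rewrite ?ln1 // ln0.
  have arms0 ds : @rse_arms R K T D B ds T 1 finset.setT [::] = [::].
    by case: T T1 {L0} => [|[|]].
  rewrite /rse_regret big1 => [|w _]; last by rewrite arms0 big_nil mulr0.
  by rewrite addr_ge0 // sumr_ge0 // => i _; rewrite L0 mulr0 mul0r.
apply: le_trans (regret_le D0 p0 p1 best B_ge T2) _; rewrite lerD2r.
by apply: ler_sum => i di; rewrite -mulrA ler_wpM2r ?ler_nat ?ln_ratio_ge0.
Qed.
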